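(* Consider the smart-metering model described in the context with infinite horizon. Suppose there exist a constant $J\in\mathbb R$ and a function $v:\mathcal P_{X,S}\to\mathbb R$ satisfying $$J+v(\pi)=\min_{a\in\mathcal A}[\mathscr B_a v](\pi)\qquad\forall \pi\in\mathcal P_{X,S}.$$ Let $f^*(\pi)$ denote a minimizer of the right-hand side. Then the time-homogeneous policy $\mathbf q^*$ given by $q^*(y\mid x_t,s_t,\pi_t)=a(y\mid x_t,s_t)$ with $a=f^*(\pi_t)$ (where $\pi_t$ is the belief state) is optimal, i.e. it minimizes $L_\infty$ over $\mathcal Q_A$; hence there is no loss of optimality in restricting to time-homogeneous policies of the form $q(y_t\mid x_t,s_t,\pi_t)$. Moreover the optimal infinite-horizon leakage rate $\inf_{\mathbf q\in\mathcal Q_A}L_\infty(\mathbf q)$ equals $J$.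
   Context: Let $\mathcal X=\{0,\dots,m_x\}$, $\mathcal Y=\{0,\dots,m_y\}$, $\mathcal S=\{0,\dots,m_s\}$ with $m_x\le m_y$. The demand $\{X_t\}_{t\ge1}$ is a time-homogeneous first-order Markov chain on $\mathcal X$ with irreducible aperiodic transition matrix $Q(x'\mid x)$ and initial pmf $P_{X_1}$; the initial battery charge $S_1\in\mathcal S$ has pmf $P_{S_1}$ and is independent of $\{X_t\}$. For an integer $w$ let $\mathcal Y_\circ(w)=\{y\in\mathcal Y: w+y\in\mathcal S\}$. A charging policy $\mathbf q=(q_1,q_2,\dots)$ is a sequence of conditional pmfs $q_t(y\mid x^t,s^t,y^{t-1})$ on $\mathcal Y$ with $\sum_{y\in\mathcal Y_\circ(s_t-x_t)}q_t(y\mid x^t,s^t,y^{t-1})=1$; $\mathcal Q_A$ is the set of all such policies. The joint law is $P^{\mathbf q}(s^T,x^T,y^T)=P_{S_1}(s_1)P_{X_1}(x_1)q_1(y_1|x_1,s_1)\prod_{t=2}^T\mathbf 1\{s_t=s_{t-1}-x_{t-1}+y_{t-1}\}Q(x_t|x_{t-1})q_t(y_t|x^t,s^t,y^{t-1})$. Leakage rates: $L_T(\mathbf q)=\frac1T I^{\mathbf q}(X^T,S_1;Y^T)$ and $L_\infty(\mathbf q)=\limsup_{T\to\infty}L_T(\mathbf q)$. $\mathcal P_{X,S}$ is the set of pmfs on $\mathcal X\times\mathcal S$; $\mathcal A$ is the set of conditional pmfs $a(y\mid x,s)$ with $a(\mathcal Y_\circ(s-x)\mid x,s)=1$ for all $(x,s)$.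 $I(a;\pi)$ is the mutual information between $(X,S)\sim\pi$ and $Y\sim a(\cdot\mid X,S)$. The filter is $\varphi(\pi,y,a)(x',s')=\frac{\sum_{x}Q(x'|x)a(y|x,s'+x-y)\pi(x,s'+x-y)}{\sum_{x,s}a(y|x,s)\pi(x,s)}$ (terms with $s'+x-y\notin\mathcal S$ are zero; arbitrary pmf if the denominator vanishes), and $[\mathscr B_aV](\pi)=I(a;\pi)+\sum_{x,s,y}\pi(x,s)a(y|x,s)V(\varphi(\pi,y,a))$. The belief state is $\pi_t(x,s)=P^{\mathbf q}(X_t=x,S_t=s\mid Y^{t-1}=y^{t-1})$, updated by $\pi_{t+1}=\varphi(\pi_t,y_t,a_t)$. *)

(* Defs.v *)
From HB Require Import structures.
From mathcomp Require Import all_boot all_order all_algebra.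
From mathcomp Require Import all_classical all_reals all_analysis.
Set Implicit Arguments. Unset Strict Implicit. Unset Printing Implicit Defensive.
Import Order.TTheory GRing.Theory Num.Theory.
Local Open Scope ring_scope.

(* Alphabets: X = {0..mx} = 'I_mx.+1, Y = 'I_my.+1, S = 'I_ms.+1.
   Q is a square matrix with  Q x x' = Q(x' | x).
   A pmf on X x S is a function pi : X -> S -> R, written pi x s.
   A conditional pmf a(y|x,s) is a function a : X -> S -> Y -> R, a x s y. *)

Definition stochastic (R : realType) (n : nat) (Q : 'M[R]_n.+1) : Prop :=
  (forall i j, 0 <= Q i j) /\ (forall i, \sum_j Q i j = 1).

Definition irreducible (R : realType) (n : nat) (Q : 'M[R]_n.+1) : Prop :=
  forall i j, exists k : nat, 0 < (Q ^+ k) i j.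

(* aperiodic: for every state, the gcd of the return times
   {k > 0 | Q^k(i,i) > 0} is 1, i.e. every common divisor is 1 *)
Definition aperiodic (R : realType) (n : nat) (Q : 'M[R]_n.+1) : Prop :=
  forall i (d : nat),
    (forall k : nat, (0 < k)%N -> 0 < (Q ^+ k) i i -> (d %| k)%N) -> d = 1%N.

Definition is_pmf (R : realType) (T : finType) (p : T -> R) : Prop :=
  (forall t, 0 <= p t) /\ \sum_t p t = 1.

Definition is_pmfXS (R : realType) (mx ms : nat)
  (pi : 'I_mx.+1 -> 'I_ms.+1 -> R) : Prop :=
  (forall x s, 0 <= pi x s) /\ \sum_x \sum_s pi x s = 1.

(* y is in Y_o(s - x), i.e. s - x + y lies in {0..ms} *)
Definition feasible (ms : nat) (s x y : nat) : bool :=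
  (x <= s + y)%N && (s + y <= ms + x)%N.

Definition admissible (R : realType) (mx my ms : nat)
  (a : 'I_mx.+1 -> 'I_ms.+1 -> 'I_my.+1 -> R) : Prop :=
  forall x s, (forall y, 0 <= a x s y) /\ \sum_y a x s y = 1 /\
              \sum_(y : 'I_my.+1 | feasible ms s x y) a x s y = 1.

(* mutual information of a joint pmf p on A x B (natural log, 0 log 0 = 0) *)
Definition MI (R : realType) (A B : finType) (p : A -> B -> R) : R :=
  \sum_a \sum_b (if p a b == 0 then 0 else
     p a b * ln (p a b / ((\sum_b' p a b') * (\sum_a' p a' b)))).

Definition Iact (R : realType) (mx my ms : nat)
  (a : 'I_mx.+1 -> 'I_ms.+1 -> 'I_my.+1 -> R) (pi : 'I_mx.+1 -> 'I_ms.+1 -> R) : R :=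
  MI (fun (xs : 'I_mx.+1 * 'I_ms.+1) (y : 'I_my.+1) => pi xs.1 xs.2 * a xs.1 xs.2 y).

Definition prevS (ms : nat) (s' x y : nat) : option 'I_ms.+1 :=
  if (y <= s' + x)%N then insub (s' + x - y)%N else None.

(* the filter phi(pi,y,a); phi0 is the (arbitrary) pmf used when the
   denominator vanishes *)
Definition filt (R : realType) (mx my ms : nat) (Q : 'M[R]_mx.+1)
  (phi0 : ('I_mx.+1 -> 'I_ms.+1 -> R) -> 'I_my.+1 ->
          ('I_mx.+1 -> 'I_ms.+1 -> 'I_my.+1 -> R) -> 'I_mx.+1 -> 'I_ms.+1 -> R)
  (pi : 'I_mx.+1 -> 'I_ms.+1 -> R) (y : 'I_my.+1)
  (a : 'I_mx.+1 -> 'I_ms.+1 -> 'I_my.+1 -> R) : 'I_mx.+1 -> 'I_ms.+1 -> R :=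
  let den := \sum_x \sum_s a x s y * pi x s in
  if den == 0 then phi0 pi y a else
  fun x' s' => (\sum_(x : 'I_mx.+1) match prevS ms s' x y with
                        | Some s => Q x x' * a x s y * pi x s
                        | None => 0 end) / den.

Definition bellman (R : realType) (mx my ms : nat) (Q : 'M[R]_mx.+1)
  (phi0 : ('I_mx.+1 -> 'I_ms.+1 -> R) -> 'I_my.+1 ->
          ('I_mx.+1 -> 'I_ms.+1 -> 'I_my.+1 -> R) -> 'I_mx.+1 -> 'I_ms.+1 -> R)
  (a : 'I_mx.+1 -> 'I_ms.+1 -> 'I_my.+1 -> R)
  (V : ('I_mx.+1 -> 'I_ms.+1 -> R) -> R) (pi : 'I_mx.+1 -> 'I_ms.+1 -> R) : R :=
  Iact a pi + \sum_x \sum_s \sum_y pi x s * a x s y * V (filt Q phi0 pi y a).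

(* A charging policy: q t xs ss ys y = q_{t+1}(y | x^{t+1}, s^{t+1}, y^t)
   (time index t is 0-based: q 0 is q_1), histories given as sequences. *)
Definition policy (R : realType) (mx my ms : nat) :=
  nat -> seq 'I_mx.+1 -> seq 'I_ms.+1 -> seq 'I_my.+1 -> 'I_my.+1 -> R.

Definition valid_policy (R : realType) (mx my ms : nat) (q : policy R mx my ms) : Prop :=
  forall (t : nat) xs ss ys, size xs = t.+1 -> size ss = t.+1 -> size ys = t ->
    (forall y, 0 <= q t xs ss ys y) /\ \sum_y q t xs ss ys y = 1 /\
    \sum_(y : 'I_my.+1 | feasible ms (nth ord0 ss t) (nth ord0 xs t) y) q t xs ss ys y = 1.

Definition jointP (R : realType) (mx my ms : nat) (Q : 'M[R]_mx.+1)
  (PX1 : 'I_mx.+1 -> R) (PS1 : 'I_ms.+1 -> R) (q : policy R mx my ms) (T : nat)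
  (xs : seq 'I_mx.+1) (ss : seq 'I_ms.+1) (ys : seq 'I_my.+1) : R :=
  \prod_(t < T)
    ((if t == 0%N :> nat then PS1 (nth ord0 ss 0) * PX1 (nth ord0 xs 0)
      else ((nth ord0 ss t + nth ord0 xs t.-1 ==
             nth ord0 ss t.-1 + nth ord0 ys t.-1)%N)%:R
           * Q (nth ord0 xs t.-1) (nth ord0 xs t))
     * q t (take t.+1 xs) (take t.+1 ss) (take t ys) (nth ord0 ys t)).

Definition jointXS1Y (R : realType) (mx my ms : nat) (Q : 'M[R]_mx.+1)
  (PX1 : 'I_mx.+1 -> R) (PS1 : 'I_ms.+1 -> R) (q : policy R mx my ms) (T : nat)
  (xs1 : T.-tuple 'I_mx.+1 * 'I_ms.+1) (ys : T.-tuple 'I_my.+1) : R :=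
  \sum_(ss : T.-tuple 'I_ms.+1 | nth ord0 ss 0 == xs1.2)
    jointP Q PX1 PS1 q T xs1.1 ss ys.

Definition leakT (R : realType) (mx my ms : nat) (Q : 'M[R]_mx.+1)
  (PX1 : 'I_mx.+1 -> R) (PS1 : 'I_ms.+1 -> R) (q : policy R mx my ms) (T : nat) : R :=
  MI (@jointXS1Y R mx my ms Q PX1 PS1 q T) / T%:R.

Definition leakInf (R : realType) (mx my ms : nat) (Q : 'M[R]_mx.+1)
  (PX1 : 'I_mx.+1 -> R) (PS1 : 'I_ms.+1 -> R) (q : policy R mx my ms) : \bar R :=
  limn_esup (fun T => (leakT Q PX1 PS1 q T)%:E).

(* belief state pi_{t+1} after observing y^t, when at each step the action
   f(pi_t) is used; pi_1 = P_{X_1} x P_{S_1} *)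
Definition belief (R : realType) (mx my ms : nat) (Q : 'M[R]_mx.+1)
  (PX1 : 'I_mx.+1 -> R) (PS1 : 'I_ms.+1 -> R)
  (phi0 : ('I_mx.+1 -> 'I_ms.+1 -> R) -> 'I_my.+1 ->
          ('I_mx.+1 -> 'I_ms.+1 -> 'I_my.+1 -> R) -> 'I_mx.+1 -> 'I_ms.+1 -> R)
  (f : ('I_mx.+1 -> 'I_ms.+1 -> R) -> 'I_mx.+1 -> 'I_ms.+1 -> 'I_my.+1 -> R)
  (ys : seq 'I_my.+1) : 'I_mx.+1 -> 'I_ms.+1 -> R :=
  foldl (fun pi y => filt Q phi0 pi y (f pi)) (fun x s => PX1 x * PS1 s) ys.

Definition belief_policy (R : realType) (mx my ms : nat) (Q : 'M[R]_mx.+1)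
  (PX1 : 'I_mx.+1 -> R) (PS1 : 'I_ms.+1 -> R)
  (phi0 : ('I_mx.+1 -> 'I_ms.+1 -> R) -> 'I_my.+1 ->
          ('I_mx.+1 -> 'I_ms.+1 -> 'I_my.+1 -> R) -> 'I_mx.+1 -> 'I_ms.+1 -> R)
  (f : ('I_mx.+1 -> 'I_ms.+1 -> R) -> 'I_mx.+1 -> 'I_ms.+1 -> 'I_my.+1 -> R)
  : policy R mx my ms :=
  fun t xs ss ys y =>
    f (belief Q PX1 PS1 phi0 f ys) (nth ord0 xs t) (nth ord0 ss t) y.

(* Main.v *)
Require Import Defs.
From HB Require Import structures.
From mathcomp Require Import all_boot all_order all_algebra.
From mathcomp Require Import all_classical all_reals all_analysis.
From mathcomp Require Import zify ring lra.
Import Order.TTheory GRing.Theory Num.Theory.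
Local Open Scope ring_scope.

(** The chain rule splits [I(X^T, S_1; Y^T)] into per-step gains, each at least the
    mean of [I(a_t; pi_t)] (data processing), with equality for belief policies.
    Iterating the optimality equation gives
    [J T + v(pi_1) <= I(X^T, S_1; Y^T) + E v(pi_(T+1))], with equality for the
    minimizing policy, so the theorem holds as soon as [v] is bounded along the
    belief process.

    The equation forces this bound. Extended homogeneously to unnormalized beliefs,
    it bounds the value of a belief by a cost plus the sum of the values of its
    unnormalized posteriors, for every action. From above: the charge can be disclosed
    in boundedly many steps (up to a letter that leaves the charge distribution
    unchanged), after which the belief lies in a finite set. From below: any belief of
    the process is reached from a fixed belief in boundedly many steps with a
    probability bounded away from 0. The only obstacle is a state where the letter is
    forced, namely zero demand with a full battery, or its mirror image; the weight of
    that state has to be prepared by an earlier letter.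

    If the demand is constant then [I(X^T, S_1; Y^T)] is bounded and [J = 0]. *)

Set Implicit Arguments. Unset Strict Implicit. Unset Printing Implicit Defensive.

Lemma finite_upper_bound (R : realDomainType) (I : finType) (F : I -> R) :
  exists2 B, 0 <= B & forall i, F i <= B.
Proof.
exists (\sum_i `|F i|); first exact: sumr_ge0.
by move=> i; rewrite (bigD1 i) //= (le_trans (ler_norm _)) // lerDl sumr_ge0.
Qed.

Lemma ord_eq0 n (i : 'I_n.+1) : n = 0%N -> i = ord0.
Proof. by move=> n0; apply/val_inj => /=; have := ltn_ord i; lia. Qed.

Lemma full_subsum_support (R : numDomainType) (I : finType) (P : pred I) (F : I -> R) i :
  (forall j, 0 <= F j) -> \sum_(j | P j) F j = \sum_j F j -> F i != 0 -> P i.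
Proof.
move=> F0 eqF; apply: contraNT => nPi.
have : \sum_(j | ~~ P j) F j = 0.
  by move: eqF; rewrite [RHS](bigID P) /= => /esym/(canRL (addKr _)); rewrite addNr.
by move/psumr_eq0P => ->.
Qed.

Lemma ler_sum_term (R : numDomainType) (I : finType) (F : I -> R) i :
  (forall j, 0 <= F j) -> F i <= \sum_j F j.
Proof. by move=> F0; rewrite (bigD1 i) //= lerDl sumr_ge0. Qed.

(** * Unnormalized beliefs *)

Section Measures.
Variables (R : realType) (mx ms : nat).
Local Notation X := 'I_mx.+1.
Local Notation S := 'I_ms.+1.
Implicit Types (mu nu h : X -> S -> R) (F G : (X -> S -> R) -> R) (c : R).

Definition nonneg mu := forall x s, 0 <= mu x s.

Definition mass mu : R := \sum_x \sum_s mu x s.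

Definition weigh h mu : X -> S -> R := fun x s => h x s * mu x s.

Definition scale c mu : X -> S -> R := fun x s => c * mu x s.

Definition normalize mu : X -> S -> R := fun x s => mu x s / mass mu.

(* The extension of [F] to measures that is homogeneous of degree 1. *)
Definition perspective F mu : R := mass mu * F (normalize mu).

Lemma pmf_nonneg mu : is_pmfXS mu -> nonneg mu. Proof. by case. Qed.

Lemma pmf_mass mu : is_pmfXS mu -> mass mu = 1. Proof. by case. Qed.

Lemma nonneg_weigh h mu : nonneg h -> nonneg mu -> nonneg (weigh h mu).
Proof. by move=> h0 mu0 x s; rewrite mulr_ge0. Qed.

Lemma nonneg_scale c mu : 0 <= c -> nonneg mu -> nonneg (scale c mu).
Proof. by move=> c0 mu0 x s; rewrite mulr_ge0. Qed.

Lemma mass_ge0 mu : nonneg mu -> 0 <= mass mu.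
Proof. by move=> mu0; apply: sumr_ge0 => x _; exact: sumr_ge0. Qed.

Lemma le_mass mu x s : nonneg mu -> mu x s <= mass mu.
Proof.
move=> mu0; apply: (@le_trans _ _ (\sum_s' mu x s')); first exact: ler_sum_term.
by apply: (ler_sum_term x) => x'; exact: sumr_ge0.
Qed.

Lemma ler_mass mu nu : (forall x s, mu x s <= nu x s) -> mass mu <= mass nu.
Proof. by move=> le_mu_nu; apply: ler_sum => x _; exact: ler_sum. Qed.

Lemma mass_eq0 mu x s : nonneg mu -> mass mu = 0 -> mu x s = 0.
Proof. by move=> mu0 m0; apply/le_anti; rewrite mu0 -m0 le_mass. Qed.

Lemma mass_neq0 mu : mass mu != 0 -> exists x s, mu x s != 0.
Proof.
apply: contraNP => nE; rewrite /mass big1 // => x _; rewrite big1 // => s _.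
by apply/eqP; apply: contra_notT nE => mu_n0; exists x, s.
Qed.

Lemma mass_scale c mu : mass (scale c mu) = c * mass mu.
Proof. by rewrite /mass mulr_sumr; apply: eq_bigr => x _; rewrite mulr_sumr. Qed.

Lemma pmf_normalize mu : nonneg mu -> mass mu != 0 -> is_pmfXS (normalize mu).
Proof.
move=> mu0 mn; split=> [x s|]; first by rewrite divr_ge0 // mass_ge0.
rewrite -(divff mn) {2}/mass mulr_suml.
by apply: eq_bigr => x _; rewrite mulr_suml.
Qed.

Lemma scale_normalize mu : nonneg mu -> scale (mass mu) (normalize mu) = mu.
Proof.
move=> mu0; apply/funext => x; apply/funext => s; rewrite /scale /normalize.
have [m0|mn] := eqVneq (mass mu) 0; first by rewrite m0 mul0r mass_eq0.
by rewrite mulrC divfK.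
Qed.

Lemma weigh_scale h c mu : weigh h (scale c mu) = scale c (weigh h mu).
Proof. by apply/funext => x; apply/funext => s; rewrite /weigh /scale mulrCA. Qed.

Lemma normalize_scale c mu : c != 0 -> normalize (scale c mu) = normalize mu.
Proof.
move=> c_n0; apply/funext => x; apply/funext => s.
by rewrite /normalize mass_scale /scale -mulf_div divff // mul1r.
Qed.

Lemma scale_scale c1 c2 mu : scale c1 (scale c2 mu) = scale (c1 * c2) mu.
Proof. by apply/funext => x; apply/funext => s; rewrite /scale mulrA. Qed.

Lemma perspective_scale F c mu : perspective F (scale c mu) = c * perspective F mu.
Proof.
rewrite /perspective mass_scale -mulrA; have [->|c_n0] := eqVneq c 0; first by rewrite !mul0r.
by rewrite normalize_scale.
Qed.

Lemma perspective_mass0 F mu : mass mu = 0 -> perspective F mu = 0.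
Proof. by rewrite /perspective => ->; rewrite mul0r. Qed.

Lemma perspective_pmf F mu : is_pmfXS mu -> perspective F mu = F mu.
Proof.
move=> pmf_mu; rewrite /perspective pmf_mass // mul1r; congr F.
by apply/funext => x; apply/funext => s; rewrite /normalize pmf_mass // divr1.
Qed.

Lemma perspective_le F G mu : nonneg mu ->
  (forall p, is_pmfXS p -> F p <= G p) -> perspective F mu <= perspective G mu.
Proof.
move=> mu0 le_FG; have [m0|mn] := eqVneq (mass mu) 0; first by rewrite !perspective_mass0.
by rewrite ler_wpM2l ?mass_ge0 //; apply: le_FG; exact: pmf_normalize.
Qed.

Lemma perspective_le_finite_family F (I : finType) (family : I -> X -> S -> R) :
  (forall i, nonneg (family i)) ->
  exists2 B, 0 <= B & forall i, perspective F (family i) <= B * mass (family i).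
Proof.
move=> fam0; have [B B0 le_B] := finite_upper_bound (fun i => F (normalize (family i))).
by exists B => // i; rewrite mulrC ler_wpM2l ?mass_ge0.
Qed.

End Measures.

Section Filter.
Variables (R : realType) (mx my ms : nat) (Q : 'M[R]_mx.+1).
Local Notation X := 'I_mx.+1.
Local Notation Y := 'I_my.+1.
Local Notation S := 'I_ms.+1.
Implicit Types (x : X) (y : Y) (s : S) (mu h : X -> S -> R) (a : X -> S -> Y -> R) (c : R).

(* The mass of demand [x] that letter [y] moves to charge [s']: at most one term. *)
Definition inflow y mu : X -> S -> R :=
  fun x s' => \sum_(s : S | (s + y == s' + x)%N) mu x s.

Definition advance y mu : X -> S -> R :=
  fun x' s' => \sum_(x : X) inflow y mu x s' * Q x x'.

(* The value of [g] at the charge reached from [s]; 0 if [y] is not feasible. *)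
Definition at_next_charge y x (g : S -> R) s : R :=
  \sum_(s' : S | (s + y == s' + x)%N) g s'.

(* The adjoint of [advance]. *)
Definition backward y h : X -> S -> R :=
  fun x s => \sum_(x' : X) Q x x' * at_next_charge y x (h x') s.

Definition likelihood a y : X -> S -> R := fun x s => a x s y.

Definition supports_letter y mu := forall x s, mu x s != 0 -> feasible ms s x y.

Lemma inflow_next y mu x s s' : (s + y = s' + x)%N -> inflow y mu x s' = mu x s.
Proof.
move=> e; rewrite /inflow (big_pred1 s) // => s0 /=.
by rewrite -e eqn_add2r.
Qed.

Lemma inflow_neq0 y mu x s' : inflow y mu x s' != 0 ->
  exists2 s : S, (s + y = s' + x)%N & mu x s != 0.
Proof.
apply: contraNP => nE; rewrite /inflow big1 // => s /eqP e.
by apply/eqP; apply: contra_notT nE => mu_n0; exists s.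
Qed.

Lemma advance_scale y c mu : advance y (scale c mu) = scale c (advance y mu).
Proof.
apply/funext => x'; apply/funext => s'; rewrite /scale /advance mulr_sumr.
by apply: eq_bigr => x _; rewrite /inflow -mulr_sumr mulrA.
Qed.

Lemma advance_neq0 y mu x' s' : advance y mu x' s' != 0 ->
  exists2 x, Q x x' != 0 & inflow y mu x s' != 0.
Proof.
apply: contraNP => nE; rewrite /advance big1 // => x _; apply/eqP.
by apply: contra_notT nE; rewrite mulf_eq0 negb_or => /andP[]; exists x.
Qed.

Lemma feasibleP s x y : reflect (exists s' : S, (s + y = s' + x)%N) (feasible ms s x y).
Proof.
apply: (iffP idP) => [/andP[le_x le_ms]|[s' e]].
  have lt_ms : (s + y - x < ms.+1)%N by lia.
  by exists (Ordinal lt_ms); rewrite /= subnK.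
by rewrite /feasible; have := ltn_ord s'; lia.
Qed.

Lemma at_next_chargeE y x (g : S -> R) s s' : (s + y = s' + x)%N -> at_next_charge y x g s = g s'.
Proof.
move=> e; rewrite /at_next_charge (big_pred1 s') // => s1 /=.
by rewrite e eqn_add2r eq_sym.
Qed.

Lemma at_next_charge_infeasible y x (g : S -> R) s : ~~ feasible ms s x y ->
  at_next_charge y x g s = 0.
Proof.
move=> infeas; rewrite /at_next_charge big_pred0 // => s'.
by apply: contraNF infeas => /eqP e; apply/feasibleP; exists s'.
Qed.

Lemma mass_weigh_advance y h mu :
  mass (weigh h (advance y mu)) = mass (weigh (backward y h) mu).
Proof.
rewrite /mass /weigh.
under eq_bigr => x' _ do under eq_bigr => s' _ do rewrite mulr_sumr.
under eq_bigr => x' _ do rewrite exchange_big /=.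
rewrite exchange_big /=; apply: eq_bigr => x _.
under eq_bigr => x' _.
  under eq_bigr => s' _ do rewrite mulrCA mulr_suml big_mkcond /=.
  rewrite exchange_big /=; over.
rewrite exchange_big /=; apply: eq_bigr => s _; rewrite mulr_suml.
apply: eq_bigr => x' _; rewrite mulr_sumr mulr_suml [RHS]big_mkcond /=.
by apply: eq_bigr => s' _; case: ifP => // _; ring.
Qed.

Lemma prevSE s' x y (F : S -> R) :
  (match prevS ms s' x y with Some s => F s | None => 0 end) =
  \sum_(s : S | (s + y == s' + x)%N) F s.
Proof.
rewrite /prevS; case: leqP => le_y; last first.
  by rewrite big_pred0 // => s; apply/negbTE; lia.
case: insubP => /= [s _ es | not_lt].
  rewrite (big_pred1 s) // => t /=; apply/eqP/eqP => [e|->]; last by lia.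
  by apply/val_inj => /=; lia.
by rewrite big_pred0 // => s; apply/negbTE; have := ltn_ord s; move: not_lt; lia.
Qed.

Lemma admissible_feasible a x s y : admissible a -> a x s y != 0 -> feasible ms s x y.
Proof.
move=> /(_ x s)[a0 [a1 a1_feas]].
by apply: (@full_subsum_support _ _ (fun y' : Y => feasible ms s x y')); rewrite ?a1.
Qed.

Lemma nonneg_likelihood a y : admissible a -> nonneg (likelihood a y).
Proof. by move=> adm_a x s; have [a0 _] := adm_a x s; exact: a0. Qed.

Lemma weigh_supports h mu y : supports_letter y h -> supports_letter y (weigh h mu).
Proof. by move=> supp_h x s; rewrite mulf_eq0 => /norP[/supp_h]. Qed.

Lemma likelihood_supports a y : admissible a -> supports_letter y (likelihood a y).
Proof. by move=> adm_a x s; exact: admissible_feasible. Qed.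

Hypothesis stoQ : stochastic Q.

Lemma stochastic_ge0 i j : 0 <= Q i j. Proof. by case: stoQ. Qed.

Lemma stochastic_sum1 i : \sum_j Q i j = 1. Proof. by case: stoQ. Qed.

Lemma stochastic_le1 i j : Q i j <= 1.
Proof. by rewrite -(stochastic_sum1 i); apply: ler_sum_term => k; exact: stochastic_ge0. Qed.

Lemma inflow_ge0 y mu x s' : nonneg mu -> 0 <= inflow y mu x s'.
Proof. by move=> mu0; exact: sumr_ge0. Qed.

Lemma nonneg_advance y mu : nonneg mu -> nonneg (advance y mu).
Proof.
move=> mu0 x' s'; apply: sumr_ge0 => x _.
by rewrite mulr_ge0 ?inflow_ge0 ?stochastic_ge0.
Qed.

Lemma mass_advance y mu : supports_letter y mu -> mass (advance y mu) = mass mu.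
Proof.
move=> supp_mu; transitivity (mass (weigh (fun _ _ => 1) (advance y mu))).
  by apply: eq_bigr => x _; apply: eq_bigr => s _; rewrite /weigh mul1r.
rewrite mass_weigh_advance; apply: eq_bigr => x _; apply: eq_bigr => s _.
rewrite /weigh; have [->|/supp_mu feas] := eqVneq (mu x s) 0; first by rewrite mulr0.
have [s' e] := feasibleP _ _ _ feas; rewrite /backward.
under eq_bigr => x' _ do rewrite (at_next_chargeE _ e) mulr1.
by rewrite stochastic_sum1 mul1r.
Qed.

(* The filter without its normalization. *)
Definition observe a y mu : X -> S -> R := advance y (weigh (likelihood a y) mu).

Lemma nonneg_observe a y mu : admissible a -> nonneg mu -> nonneg (observe a y mu).
Proof.
move=> adm_a mu0; apply/nonneg_advance/nonneg_weigh => //.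
exact: nonneg_likelihood.
Qed.

Lemma mass_observe_ge0 a y mu : admissible a -> nonneg mu -> 0 <= mass (observe a y mu).
Proof. by move=> adm_a mu0; apply/mass_ge0/nonneg_observe. Qed.

Lemma mass_observe a y mu : admissible a ->
  mass (observe a y mu) = mass (weigh (likelihood a y) mu).
Proof.
by move=> adm_a; apply/mass_advance/weigh_supports; exact: likelihood_supports.
Qed.

Lemma sum_mass_observe a mu : admissible a -> \sum_y mass (observe a y mu) = mass mu.
Proof.
move=> adm_a; under eq_bigr => y _ do rewrite mass_observe //.
rewrite exchange_big /=; apply: eq_bigr => x _.
rewrite exchange_big /=; apply: eq_bigr => s _.
by rewrite -mulr_suml; case: (adm_a x s) => _ [-> _]; rewrite mul1r.
Qed.

Lemma observe_scale a y c mu : observe a y (scale c mu) = scale c (observe a y mu).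
Proof. by rewrite /observe weigh_scale advance_scale. Qed.

Lemma filt_observe phi0 mu y a : admissible a -> mass (observe a y mu) != 0 ->
  filt Q phi0 mu y a = normalize (observe a y mu).
Proof.
move=> adm_a mn; apply/funext => x'; apply/funext => s'.
move: mn; rewrite /normalize mass_observe // => mn; rewrite /filt (negbTE mn); congr (_ / _).
apply: eq_bigr => x _; rewrite prevSE /inflow mulr_suml.
by apply: eq_bigr => s _; rewrite /weigh /likelihood; ring.
Qed.

Lemma observe_filt phi0 mu y a : admissible a -> nonneg mu ->
  observe a y mu = scale (mass (observe a y mu)) (filt Q phi0 mu y a).
Proof.
move=> adm_a mu0; have obs0 := nonneg_observe y adm_a mu0.
have [m0|mn] := eqVneq (mass (observe a y mu)) 0; last by rewrite filt_observe ?scale_normalize.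
by apply/funext => x; apply/funext => s; rewrite /scale m0 mul0r mass_eq0.
Qed.

Lemma bellman_observe phi0 a v mu : admissible a ->
  bellman Q phi0 a v mu = Iact a mu + \sum_y perspective v (observe a y mu).
Proof.
move=> adm_a; rewrite /bellman; congr (_ + _).
under eq_bigr => x _ do rewrite exchange_big /=.
rewrite exchange_big /=; apply: eq_bigr => y _.
under eq_bigr => x _ do rewrite -mulr_suml.
rewrite -mulr_suml.
have -> : \sum_x \sum_s mu x s * a x s y = mass (observe a y mu).
  rewrite mass_observe // /mass; apply: eq_bigr => x _; apply: eq_bigr => s _; exact: mulrC.
have [m0|mn] := eqVneq (mass (observe a y mu)) 0; first by rewrite perspective_mass0 // m0 mul0r.
by rewrite filt_observe.
Qed.

Lemma perspective_bellman phi0 a v mu : admissible a -> nonneg mu ->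
  perspective (bellman Q phi0 a v) mu =
  perspective (Iact a) mu + \sum_y perspective v (observe a y mu).
Proof.
move=> adm_a mu0; rewrite {1}/perspective bellman_observe // mulrDr.
congr (_ + _); rewrite mulr_sumr; apply: eq_bigr => y _.
by rewrite -perspective_scale -observe_scale scale_normalize.
Qed.

End Filter.

(** * Upper bound on the value function *)

Section BellmanSubsolution.
Variables (R : realType) (mx my ms : nat) (Q : 'M[R]_mx.+1).
Local Notation X := 'I_mx.+1.
Local Notation Y := 'I_my.+1.
Local Notation S := 'I_ms.+1.

Definition bellman_subsolution (v : (X -> S -> R) -> R) (C : R) :=
  forall mu (a : X -> S -> Y -> R), nonneg mu -> admissible a ->
    perspective v mu <= C * mass mu + \sum_y perspective v (observe Q a y mu).

Definition deterministic (d : X -> S -> Y) : X -> S -> Y -> R := fun x s y => (y == d x s)%:R.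

Lemma deterministic_admissible (d : X -> S -> Y) :
  (forall (x : X) (s : S), feasible ms s x (d x s)) -> admissible (deterministic d).
Proof.
move=> feas_d x s; split; first by move=> y; rewrite ler0n.
have sum1 (P : pred Y) : P (d x s) -> \sum_(y | P y) deterministic d x s y = 1.
  move=> Pd; rewrite (bigD1 (d x s)) //= big1 /deterministic ?eqxx ?addr0 // => y.
  by case/andP => _ /negbTE ->.
by split; exact: sum1.
Qed.

Lemma weigh_deterministic (d : X -> S -> Y) y mu x s :
  weigh (likelihood (deterministic d) y) mu x s = if y == d x s then mu x s else 0.
Proof. by rewrite /weigh /likelihood /deterministic; case: eqP; rewrite ?mul1r ?mul0r. Qed.

Definition prod_belief (x0 : X) (sg : S -> R) : X -> S -> R := fun x s => Q x0 x * sg s.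

Lemma prod_belief_scale x0 c sg :
  prod_belief x0 (fun s => c * sg s) = scale c (prod_belief x0 sg).
Proof. by apply/funext => x; apply/funext => s; rewrite /scale mulrCA. Qed.

Lemma advance_known_demand (x0 : X) (y : Y) mu : y = x0 :> nat ->
  (forall x s, x != x0 -> mu x s = 0) -> advance Q y mu = prod_belief x0 (mu x0).
Proof.
move=> ey mu_x0; apply/funext => x'; apply/funext => s'.
rewrite /advance (bigD1 x0) //= big1 ?addr0 => [|x xn].
  by rewrite (inflow_next mu (s := s')) 1?mulrC // ey.
by rewrite /inflow big1 ?mul0r // => s _; rewrite mu_x0.
Qed.

Hypothesis stoQ : stochastic Q.

Lemma nonneg_prod_belief x0 sg : (forall s, 0 <= sg s) -> nonneg (prod_belief x0 sg).
Proof. by move=> sg0 x s; rewrite mulr_ge0 // stochastic_ge0. Qed.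

Lemma mass_prod_belief x0 sg : mass (prod_belief x0 sg) = \sum_s sg s.
Proof.
rewrite /mass; under eq_bigr => x _ do rewrite -mulr_sumr.
by rewrite -mulr_suml stochastic_sum1 // mul1r.
Qed.

End BellmanSubsolution.

Lemma odd_le n : (odd n <= n)%N. Proof. by case: n => //= n; case: odd. Qed.

Section QueryAndFlip.
Variable ms : nat.
Local Notation S := 'I_ms.+1.
Implicit Types (s : S) (b : bool).

Definition pair_feasible (g : S -> bool -> bool) :=
  forall s b, ((b <= s + g s b) && (s + g s b <= ms + b))%N.

Definition query (a : nat) s (_ : bool) : bool := (s <= a)%N.

Lemma query_feasible a : (a < ms)%N -> pair_feasible (query a).
Proof.
by move=> lt_a s b; rewrite /query; have := ltn_ord s; case: leqP; case: b => /=; lia.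
Qed.

Definition flip (j : nat) s b : bool := if s == j :> nat then ~~ b else b.

Lemma flip_feasible j : (0 < j < ms)%N -> pair_feasible (flip j).
Proof.
by move=> j_in s b; rewrite /flip; have := ltn_ord s; case: eqP; case: b => /=; lia.
Qed.

End QueryAndFlip.

Section LetterInPairs.
Variables (mx my ms : nat).
Local Notation X := 'I_mx.+1.
Local Notation Y := 'I_my.+1.
Local Notation S := 'I_ms.+1.
Implicit Types (x : X) (s : S) (b : bool).
Hypothesis le_mx_my : (mx <= my)%N.

Definition hold_letter x (_ : S) : Y := inord x.

Lemma hold_letterE x s : hold_letter x s = x :> nat.
Proof. by rewrite /hold_letter inordK //; have := ltn_ord x; lia. Qed.

Lemma hold_letter_feasible x s : feasible ms s x (hold_letter x s).
Proof. by rewrite /feasible hold_letterE; have := ltn_ord s; lia. Qed.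

Definition unpaired (n : nat) : bool := (n == my) && ~~ odd n.

(* Letters are grouped in pairs {2j, 2j+1}. Within its pair the letter carries the
   bit [g s b], [b] the parity of [x], so it discloses [x] up to parity only and
   the charge moves by [g s b - b]. A letter [x] without partner is held. *)
Definition pair_letter (g : S -> bool -> bool) x s : Y :=
  inord (if unpaired x then x : nat else x - odd x + g s (odd x))%N.

Lemma pair_letterE g x s : pair_letter g x s =
  (if unpaired x then x : nat else x - odd x + g s (odd x))%N :> nat.
Proof.
rewrite /pair_letter inordK // /unpaired.
by have := odd_le x; have := ltn_ord x; case: (odd x); case: (g _ _); case: eqP => /=; lia.
Qed.

Lemma pair_letter_feasible g : pair_feasible g ->
  forall x s, feasible ms s x (pair_letter g x s).
Proof.
move=> feas_g x s; rewrite /feasible pair_letterE; have := feas_g s (odd x).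
by have := odd_le x; have := ltn_ord s; case: ifP; lia.
Qed.

Lemma odd_pair_letter g x s : ~~ unpaired x -> odd (pair_letter g x s) = g s (odd x).
Proof.
move=> /negbTE paired; rewrite pair_letterE paired oddD oddB ?odd_le // oddb.
by case: (odd x); case: (g _ _).
Qed.

Lemma unpaired_pair_letter g x s : unpaired (pair_letter g x s) = unpaired x.
Proof.
have [unp|paired] := boolP (unpaired x); first by rewrite pair_letterE unp.
apply: contraNF (paired) => /andP[/eqP em even_l].
rewrite /unpaired; move: em even_l; rewrite odd_pair_letter // pair_letterE (negbTE paired).
by have := odd_le x; have := ltn_ord x; case: (odd x); case: (g _ _) => //=; lia.
Qed.

Lemma unpaired_max x : unpaired x -> x = ord_max /\ my = mx.
Proof.
move=> /andP[/eqP e _]; have := ltn_ord x => lt_x.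
by split; [apply/val_inj => /= |]; lia.
Qed.

End LetterInPairs.

Section QueryAndFlipRanges.
Variables (a t s L : nat) (b : bool).

Lemma query_determined (o : bool) : (a <= s <= a + 1)%N -> (s <= a)%N = o ->
  s = if o then a else a.+1.
Proof. by case: o; lia. Qed.

Lemma query_true_range : (a <= t <= a + L.+2)%N -> (t <= a)%N = true ->
  (t + (t <= a) = s + b)%N -> (a <= s <= a + 1)%N.
Proof. by case: b => /=; lia. Qed.

Lemma query_false_range : (a <= t <= a + L.+2)%N -> t <> a.+1 -> (t <= a)%N = false ->
  (t + (t <= a) = s + b)%N -> (a.+1 <= s <= a.+1 + L.+1)%N.
Proof. by case: b => /=; lia. Qed.

Lemma flip_range : (a <= t <= a + L.+2)%N ->
  (t + (if t == a.+1 then ~~ b else b) = s + b)%N ->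
  (a <= s <= a + L.+2)%N /\ s <> a.+1.
Proof. by case: eqP; case: b => /=; lia. Qed.

End QueryAndFlipRanges.

Section UpperBound.
Variables (R : realType) (mx my ms : nat) (Q : 'M[R]_mx.+1).
Local Notation X := 'I_mx.+1.
Local Notation Y := 'I_my.+1.
Local Notation S := 'I_ms.+1.
Variables (v : (X -> S -> R) -> R) (C : R).
Hypotheses (le_mx_my : (mx <= my)%N) (stoQ : stochastic Q) (C_ge0 : 0 <= C).
Hypothesis subsol : bellman_subsolution my Q v C.
Implicit Types (x : X) (y : Y) (s : S) (b : bool) (mu : X -> S -> R) (sg : S -> R) (B : R).
Implicit Types (g : S -> bool -> bool).

Local Notation V := (perspective v).
Local Notation hold := (@hold_letter mx my ms).
Local Notation after d y mu := (observe Q (deterministic R d) y mu).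

Lemma value_le_of_outcomes (d : X -> S -> Y) mu B :
  (forall x s, feasible ms s x (d x s)) -> nonneg mu ->
  (forall y, V (after d y mu) <= B * mass (after d y mu)) -> V mu <= (C + B) * mass mu.
Proof.
move=> feas_d mu0 le_B; have adm_d := deterministic_admissible R feas_d.
apply: (le_trans (subsol mu0 adm_d)); rewrite mulrDl lerD2l.
by rewrite -(sum_mass_observe stoQ mu adm_d) mulr_sumr; exact: ler_sum.
Qed.

Lemma observe_hold x y mu : y = x :> nat -> after hold y mu = prod_belief Q x (mu x).
Proof.
move=> ey; have holdE x1 s : (y == hold x1 s) = (x1 == x).
  by rewrite -val_eqE /= hold_letterE // ey eq_sym.
rewrite /observe (advance_known_demand Q ey).
  by congr prod_belief; apply/funext => s; rewrite weigh_deterministic holdE eqxx.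
by move=> x1 s /negbTE x1n; rewrite weigh_deterministic holdE x1n.
Qed.

Lemma hold_value_le (K : S -> Prop) B :
  (forall x0 sg, (forall s, 0 <= sg s) -> (forall s, sg s != 0 -> K s) ->
     V (prod_belief Q x0 sg) <= B * \sum_s sg s) ->
  forall mu, nonneg mu -> (forall x s, mu x s != 0 -> K s) -> V mu <= (C + B) * mass mu.
Proof.
move=> prod_le mu mu0 muK; apply: (value_le_of_outcomes (d := hold)) => //.
  exact: hold_letter_feasible.
move=> y; have [lt_y|gt_y] := ltnP y mx.+1.
  pose x : X := Ordinal lt_y; rewrite (@observe_hold x) // mass_prod_belief //.
  by apply: prod_le => s; [exact: mu0 | exact: muK].
suff m0 : mass (after hold y mu) = 0 by rewrite perspective_mass0 // m0 mulr0.
rewrite mass_observe //; last exact/deterministic_admissible/hold_letter_feasible.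
rewrite /mass big1 // => x _; rewrite big1 // => s _; rewrite weigh_deterministic.
by rewrite -val_eqE /= hold_letterE //; case: eqP => // e; have := ltn_ord x; lia.
Qed.

Lemma observe_pair_support g x0 sg y x' s' : ~~ unpaired my y ->
  after (pair_letter my g) y (prod_belief Q x0 sg) x' s' != 0 ->
  exists s b, [/\ sg s != 0, g s b = odd y & (s + g s b = s' + b)%N].
Proof.
move=> paired /advance_neq0[x _ /inflow_neq0[s e]].
rewrite weigh_deterministic; case: (y =P _) => [ey|_]; last by rewrite eqxx.
rewrite mulf_eq0 => /norP[_ sg_n0]; exists s, (odd x).
have paired_x : ~~ unpaired my x by move: paired; rewrite ey unpaired_pair_letter.
split=> //; first by rewrite ey odd_pair_letter.
by move: e; rewrite ey pair_letterE // (negbTE paired_x); have := odd_le x; lia.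
Qed.

Lemma observe_unpaired g x0 sg y : unpaired my mx -> unpaired my y ->
  after (pair_letter my g) y (prod_belief Q x0 sg) =
  scale (Q x0 ord_max) (prod_belief Q ord_max sg).
Proof.
move=> unp_mx unp_y; have ey : y = (ord_max : X) :> nat.
  by move: unp_mx unp_y => /andP[/eqP -> _] /andP[/eqP ->].
have pairE x s : (y == pair_letter my g x s) = (x == ord_max).
  apply/eqP/eqP => [e|->]; last by apply/val_inj; rewrite /= pair_letterE //= unp_mx.
  by move: unp_y; rewrite e unpaired_pair_letter // => /(unpaired_max le_mx_my)[].
rewrite /observe (advance_known_demand Q ey).
  rewrite -prod_belief_scale; congr prod_belief; apply/funext => s.
  by rewrite weigh_deterministic pairE eqxx.
by move=> x s /negbTE xn; rewrite weigh_deterministic pairE xn.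
Qed.

Lemma mass_weigh_unpaired g mu y : ~~ unpaired my mx -> unpaired my y ->
  mass (weigh (likelihood (deterministic R (pair_letter my g)) y) mu) = 0.
Proof.
move=> paired_mx unp_y; rewrite /mass big1 // => x _; rewrite big1 // => s _.
rewrite weigh_deterministic; case: eqP => // e; exfalso.
move: paired_mx unp_y; rewrite e unpaired_pair_letter // => /negP + unp_x; apply.
by have [ex _] := unpaired_max le_mx_my unp_x; move: unp_x; rewrite ex.
Qed.

Hypothesis Q_max_lt1 : Q ord_max ord_max < 1.

(* The unpaired letter leaves the charge distribution unchanged, so the attempt is
   repeated a geometric number of times. *)
Definition retry_bound B : R := (C + B) * (1 + (1 - Q ord_max ord_max)^-1).

Lemma retry_bound_ge0 B : 0 <= B -> 0 <= retry_bound B.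
Proof. by move=> B0; rewrite mulr_ge0 ?addr_ge0 // invr_ge0 subr_ge0 ltW. Qed.

Lemma retry_bound_ge B : 0 <= B -> C + B <= retry_bound B.
Proof. by move=> B0; rewrite ler_peMr ?addr_ge0 // lerDl invr_ge0 subr_ge0 ltW. Qed.

Section PairedLetters.
Variables (g : S -> bool -> bool) (sg : S -> R) (B : R).
Hypotheses (feas_g : pair_feasible g) (sg_ge0 : forall s, 0 <= sg s) (B_ge0 : 0 <= B).
Hypothesis paired_value_le : forall x0 y, ~~ unpaired my y ->
  V (after (pair_letter my g) y (prod_belief Q x0 sg)) <=
  B * mass (after (pair_letter my g) y (prod_belief Q x0 sg)).

Let adm_pair : admissible (deterministic R (pair_letter my g)) :=
  deterministic_admissible R (pair_letter_feasible le_mx_my feas_g).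

Lemma pair_value_step x0 : unpaired my mx -> V (prod_belief Q x0 sg) <=
  (C + B) * (\sum_s sg s) + Q x0 ord_max * V (prod_belief Q ord_max sg).
Proof.
move=> unp_mx; have mu0 := nonneg_prod_belief stoQ x0 sg_ge0.
apply: (le_trans (subsol mu0 adm_pair)); rewrite mass_prod_belief // mulrDl -addrA lerD2l.
pose top : Y := ord_max; have unp_top : unpaired my top.
  by rewrite /unpaired /= eqxx /=; have /andP[/eqP <-] := unp_mx.
rewrite (bigD1 top) //= observe_unpaired // perspective_scale addrC lerD2r.
rewrite -(mass_prod_belief (ms := ms) stoQ x0) -(sum_mass_observe stoQ _ adm_pair) mulr_sumr.
rewrite [leRHS](bigD1 top) //= ler_wpDl ?mulr_ge0 ?mass_observe_ge0 //.
apply: ler_sum => y yn; apply: paired_value_le; apply: contra yn => /andP[/eqP ey _].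
exact/eqP/val_inj.
Qed.

Lemma pair_value_le x0 : V (prod_belief Q x0 sg) <= retry_bound B * \sum_s sg s.
Proof.
have sum0 : 0 <= \sum_s sg s by exact: sumr_ge0.
have [unp_mx|paired_mx] := boolP (unpaired my mx); last first.
  apply: (@le_trans _ _ ((C + B) * \sum_s sg s)); last by rewrite ler_wpM2r // retry_bound_ge.
  rewrite -(mass_prod_belief stoQ x0); apply: (value_le_of_outcomes (d := pair_letter my g)).
  - exact: pair_letter_feasible.
  - exact: nonneg_prod_belief.
  move=> y; have [unp_y|] := boolP (unpaired my y); last exact: paired_value_le.
  have m0 : mass (after (pair_letter my g) y (prod_belief Q x0 sg)) = 0.
    by rewrite mass_observe // mass_weigh_unpaired.
  by rewrite perspective_mass0 // m0 mulr0.
have V_max : V (prod_belief Q ord_max sg) <= (C + B) * (\sum_s sg s) / (1 - Q ord_max ord_max).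
  rewrite ler_pdivlMr ?subr_gt0 // mulrBr mulr1 lerBlDr [V _ * _]mulrC.
  exact: pair_value_step.
apply: (le_trans (pair_value_step x0 unp_mx)).
rewrite /retry_bound mulrDr mulr1 [leRHS]mulrDl lerD2l.
apply: (le_trans (ler_wpM2l (stochastic_ge0 stoQ _ _) V_max)).
rewrite [leRHS]mulrAC ler_piMl ?stochastic_le1 //.
by rewrite !mulr_ge0 ?addr_ge0 // invr_ge0 subr_ge0 ltW.
Qed.

Lemma nonneg_observe_pair y x0 :
  nonneg (after (pair_letter my g) y (prod_belief Q x0 sg)).
Proof. by apply: nonneg_observe => //; exact: nonneg_prod_belief. Qed.

End PairedLetters.

Definition charge_within n L sg := forall s, sg s != 0 -> (n <= s <= n + L)%N.

Definition interval_bound L := exists2 B, 0 <= B &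
  forall n x0 sg, (forall s, 0 <= sg s) -> charge_within n L sg ->
    V (prod_belief Q x0 sg) <= B * \sum_s sg s.

Definition point_mass (s0 : S) : S -> R := fun s => (s == s0)%:R.

Lemma point_mass_ge0 s0 : forall s, 0 <= point_mass s0 s. Proof. by move=> s; rewrite ler0n. Qed.

Lemma prod_belief_point_mass x0 s0 sg : (forall s, s != s0 -> sg s = 0) ->
  prod_belief Q x0 sg = scale (sg s0) (prod_belief Q x0 (point_mass s0)).
Proof.
move=> sg_s0; rewrite -prod_belief_scale; congr prod_belief; apply/funext => s.
by rewrite /point_mass; case: eqVneq => [->|/sg_s0]; rewrite ?mulr1 ?mulr0.
Qed.

Lemma point_mass_value_le : exists2 B, 0 <= B & forall x0 s0 sg, (forall s, 0 <= sg s) ->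
  (forall s, s != s0 -> sg s = 0) -> V (prod_belief Q x0 sg) <= B * \sum_s sg s.
Proof.
have [B B0 le_B] := perspective_le_finite_family v
  (fun i : X * S => nonneg_prod_belief stoQ i.1 (point_mass_ge0 i.2)).
exists B => // x0 s0 sg sg0 sg_s0.
rewrite -(mass_prod_belief stoQ x0) (prod_belief_point_mass x0 sg_s0).
by rewrite perspective_scale mass_scale [leRHS]mulrCA ler_wpM2l // (le_B (x0, s0)).
Qed.

(* The query letter tells the two candidate charges apart, so the posterior does
   not depend on their weights. *)
Lemma observe_query_point n x0 sg y (s0 : S) : ~~ unpaired my y ->
  charge_within n 1 sg -> s0 = (if odd y then n else n.+1) :> nat ->
  after (pair_letter my (query n)) y (prod_belief Q x0 sg) =
  scale (sg s0) (after (pair_letter my (query n)) y (prod_belief Q x0 (point_mass s0))).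
Proof.
move=> paired sg_supp s0E; rewrite -advance_scale; congr advance.
apply/funext => x; apply/funext => s; rewrite /scale !weigh_deterministic.
case: eqP => [ey|]; last by rewrite mulr0.
have paired_x : ~~ unpaired my x by move: paired; rewrite ey unpaired_pair_letter.
have answer : query n s (odd x) = odd y by rewrite ey odd_pair_letter.
rewrite /prod_belief /point_mass; have [->|sn] := eqVneq s s0; first by rewrite mulr1 mulrC.
suff -> : sg s = 0 by rewrite !mulr0.
apply/eqP; apply: contraNT sn => /sg_supp s_in; apply/eqP/val_inj.
by rewrite /= s0E; exact: query_determined s_in answer.
Qed.

Lemma interval_bound1 : interval_bound 1.
Proof.
have nonneg_family (i : X * S * S * Y) : nonneg
    (after (pair_letter my (query i.1.2)) i.2 (prod_belief Q i.1.1.1 (point_mass i.1.1.2))).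
  apply/(nonneg_advance stoQ)/nonneg_weigh => [x s|]; first exact: ler0n.
  exact/(nonneg_prod_belief stoQ)/point_mass_ge0.
have [B_query B_query0 query_le] := perspective_le_finite_family v nonneg_family.
have [B_point B_point0 point_le] := point_mass_value_le.
have retry0 := retry_bound_ge0 B_query0.
exists (retry_bound B_query + B_point); first exact: addr_ge0.
move=> n x0 sg sg0 sg_supp; have sum0 : 0 <= \sum_s sg s by exact: sumr_ge0.
have [lt_n|ge_n] := ltnP n ms; last first.
  apply: (@le_trans _ _ (B_point * \sum_s sg s)); last by rewrite ler_wpM2r // lerDr.
  apply: (point_le _ ord_max) => // s sn; apply/eqP; apply: contraNT sn => /sg_supp s_in.
  by apply/eqP/val_inj => /=; have := ltn_ord s; lia.
apply: (@le_trans _ _ (retry_bound B_query * \sum_s sg s)); last by rewrite ler_wpM2r // lerDl.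
apply: (pair_value_le (query_feasible lt_n)) => // x1 y paired.
pose s0 : S := inord (if odd y then n else n.+1).
have s0E : s0 = (if odd y then n else n.+1) :> nat by rewrite inordK //; case: ifP; lia.
rewrite (observe_query_point x1 paired sg_supp s0E) perspective_scale mass_scale [leRHS]mulrCA.
by rewrite ler_wpM2l //; have := query_le (x1, s0, inord n, y); rewrite /= inordK //; lia.
Qed.

Lemma interval_bound_split L : interval_bound L.+1 -> exists2 B, 0 <= B &
  forall n x0 sg, (forall s, 0 <= sg s) -> (n < ms)%N ->
    (forall s, sg s != 0 -> (n <= s <= n + L.+2)%N /\ s <> n.+1 :> nat) ->
    V (prod_belief Q x0 sg) <= B * \sum_s sg s.
Proof.
move=> [B_long B_long0 long_le]; have [B_short B_short0 short_le] := interval_bound1.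
exists (retry_bound (C + (B_long + B_short))); first by apply: retry_bound_ge0; rewrite !addr_ge0.
move=> n x0 sg sg0 lt_n sg_supp.
apply: (pair_value_le (query_feasible lt_n)) => //; first by rewrite !addr_ge0.
move=> x1 y paired; have nu0 := nonneg_observe_pair (query_feasible lt_n) sg0 y x1.
set nu := after _ _ _ in nu0 *.
have supp_nu x s : nu x s != 0 ->
    if odd y then (n <= s <= n + 1)%N else (n.+1 <= s <= n.+1 + L.+1)%N.
  move=> /(observe_pair_support paired)[t [b [/sg_supp[t_in t_n] answer e]]].
  case: ifP => odd_y; rewrite odd_y in answer.
    exact: (query_true_range t_in answer e).
  exact: (query_false_range t_in t_n answer e).
have [odd_y|even_y] := boolP (odd y).
  apply: (@le_trans _ _ ((C + B_short) * mass nu)).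
    apply: (hold_value_le (K := fun s : S => (n <= s <= n + 1)%N)) => // [|x s].
      by move=> x2 sg2; exact: short_le.
    by move=> /supp_nu; rewrite odd_y.
  by rewrite ler_wpM2r ?mass_ge0 // lerD2l lerDr.
apply: (@le_trans _ _ ((C + B_long) * mass nu)).
  apply: (hold_value_le (K := fun s : S => (n.+1 <= s <= n.+1 + L.+1)%N)) => // [|x s].
    by move=> x2 sg2; exact: long_le.
  by move=> /supp_nu; rewrite (negbTE even_y).
by rewrite ler_wpM2r ?mass_ge0 // lerD2l lerDl.
Qed.

(* Flipping at [n + 1] empties that charge: it moves to [n] or to [n + 2]. The query at
   [n] then leaves the charge in [n, n + 1] or in [n + 1, n + L + 2]. *)
Lemma interval_boundS L : interval_bound L.+1 -> interval_bound L.+2.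
Proof.
move=> bound_L; have [B_split B_split0 split_le] := interval_bound_split bound_L.
have [B_short B_short0 short_le] := interval_bound1.
have retry0 : 0 <= retry_bound (C + B_split) by rewrite retry_bound_ge0 // addr_ge0.
exists (retry_bound (C + B_split) + B_short); first exact: addr_ge0.
move=> n x0 sg sg0 sg_supp; have sum0 : 0 <= \sum_s sg s by exact: sumr_ge0.
have [lt_n|ge_n] := ltnP n.+1 ms; last first.
  apply: (@le_trans _ _ (B_short * \sum_s sg s)); last by rewrite ler_wpM2r // lerDr.
  by apply: (short_le n) => // s /sg_supp; have := ltn_ord s; lia.
apply: (@le_trans _ _ (retry_bound (C + B_split) * \sum_s sg s)); last first.
  by rewrite ler_wpM2r // lerDl.
have feas_flip : pair_feasible (@flip ms n.+1) by apply: flip_feasible; lia.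
apply: (pair_value_le feas_flip) => //; first by rewrite addr_ge0.
move=> x1 y paired.
apply: (hold_value_le (K := fun s : S => (n <= s <= n + L.+2)%N /\ s <> n.+1 :> nat)).
- by move=> x2 sg2 sg2_0 sg2_supp; apply: (split_le n) => //; lia.
- exact: nonneg_observe_pair.
move=> x s /(observe_pair_support paired)[t [b [/sg_supp t_in _ e]]].
exact: (flip_range t_in e).
Qed.

Lemma value_upper_bound : exists2 B, 0 <= B & forall mu, nonneg mu -> V mu <= B * mass mu.
Proof.
have bound L : interval_bound L.+1.
  by elim: L => [|L IH]; [exact: interval_bound1 | exact: interval_boundS].
have [B B0 le_B] := bound ms; exists (C + B); first exact: addr_ge0.
move=> mu mu0; apply: (hold_value_le (K := fun=> True)) => // x0 sg sg0 _.
by apply: (le_B 0%N) => // s _; have := ltn_ord s; lia.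
Qed.

End UpperBound.

(** * Lower bound on the value function *)

Section LetterWeights.
Variables (R : realType) (mx my ms : nat).
Local Notation X := 'I_mx.+1.
Local Notation Y := 'I_my.+1.
Local Notation S := 'I_ms.+1.
Implicit Types (x : X) (y : Y) (s : S) (h : X -> S -> R).

Definition letter_weight y h :=
  exists2 a : X -> S -> Y -> R, admissible a & likelihood a y = h.

Definition unforced y x s := exists2 y' : Y, y' != y & feasible ms s x y'.

Lemma nonneg_letter_weight y h : letter_weight y h -> nonneg h.
Proof. by move=> [a adm_a <-]; exact: nonneg_likelihood. Qed.

Lemma letter_weight_supports y h : letter_weight y h -> supports_letter y h.
Proof. by move=> [a adm_a <-]; exact: likelihood_supports. Qed.

Lemma letter_weight_le1 y h x s : letter_weight y h -> h x s <= 1.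
Proof.
move=> [a adm_a <-]; have [a0 [a1 _]] := adm_a x s; rewrite -a1.
exact: (ler_sum_term (F := a x s)).
Qed.

Lemma letter_weight_forced y h x s : letter_weight y h ->
  (forall y', feasible ms s x y' -> y' = y) -> h x s = 1.
Proof.
move=> [a adm_a <-] forced; have [_ [a1 _]] := adm_a x s.
rewrite /likelihood -a1 (bigD1 y) //= big1 ?addr0 // => y' yn; apply/eqP.
by apply: contraNT yn => /(admissible_feasible adm_a)/forced/eqP.
Qed.

Lemma letter_weightI y h : nonneg h -> (forall x s, h x s <= 1) -> supports_letter y h ->
  (forall x s, h x s != 1 -> unforced y x s) -> letter_weight y h.
Proof.
move=> h0 h1 h_feas h_unforced.
pose alt x s : Y := odflt y [pick y' | (y' != y) && feasible ms s x y'].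
have altP x s : h x s != 1 -> (alt x s != y) && feasible ms s x (alt x s).
  move=> /h_unforced[y' yn feas]; rewrite /alt; case: pickP => [//|/(_ y')].
  by rewrite yn feas.
pose a x s y' : R := h x s * (y' == y)%:R + (1 - h x s) * (y' == alt x s)%:R.
have sum_a (P : pred Y) x s : (h x s != 0 -> P y) -> (h x s != 1 -> P (alt x s)) ->
    \sum_(y' | P y') a x s y' = 1.
  move=> Py Palt; have pick z : (\sum_(y' | P y') (y' == z)%:R = (P z)%:R :> R).
    by rewrite big_mkcond (bigD1 z) //= eqxx big1 ?addr0 => [|y' /negbTE ->]; case: ifP.
  rewrite big_split -!mulr_sumr !pick /=.
  have [e0|/Py ->] := eqVneq (h x s) 0.
    by rewrite e0 mul0r add0r subr0 mul1r Palt // e0 eq_sym oner_eq0.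
  have [->|/Palt ->] := eqVneq (h x s) 1; first by rewrite subrr mul0r addr0 mul1r.
  by rewrite -mulrDl addrC subrK mul1r.
exists a; last first.
  apply/funext => x; apply/funext => s; rewrite /likelihood /a eqxx mulr1.
  have [->|/altP/andP[/negbTE]] := eqVneq (h x s) 1; first by rewrite subrr mul0r addr0.
  by rewrite eq_sym => -> _; rewrite mulr0 addr0.
move=> x s; split; first by move=> y'; rewrite addr_ge0 ?mulr_ge0 ?ler0n ?subr_ge0.
by split; apply: sum_a => // [/h_feas|/altP/andP[]].
Qed.

End LetterWeights.

Section Reach.
Variables (R : realType) (mx my ms : nat) (Q : 'M[R]_mx.+1).
Local Notation X := 'I_mx.+1.
Local Notation Y := 'I_my.+1.
Local Notation S := 'I_ms.+1.

Definition reach_bound (v : (X -> S -> R) -> R) (K : R) :=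
  forall (y : Y) mu h, nonneg mu -> letter_weight y h ->
    perspective v mu - K * mass mu <= perspective v (advance Q y (weigh h mu)).

Inductive reachable (p : X -> S -> R) : (X -> S -> R) -> Prop :=
| reachable_start : reachable p p
| reachable_advance (y : Y) mu h : reachable p mu -> letter_weight y h ->
    reachable p (advance Q y (weigh h mu)).

Hypothesis stoQ : stochastic Q.

Lemma reachable_nonneg p mu : nonneg p -> reachable p mu -> nonneg mu.
Proof.
move=> p0; elim=> // y {}mu h _ mu0 /nonneg_letter_weight h0.
exact/nonneg_advance/nonneg_weigh.
Qed.

Lemma reach_bound_of_subsolution v C B : 0 <= B -> bellman_subsolution my Q v C ->
  (forall mu, nonneg mu -> perspective v mu <= B * mass mu) -> reach_bound v (C + B).
Proof.
move=> B0 subsol le_B y mu h mu0 [a adm_a <-]; rewrite -/(observe Q a y mu).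
have others : \sum_(y' | y' != y) perspective v (observe Q a y' mu) <= B * mass mu.
  rewrite -(sum_mass_observe stoQ mu adm_a) mulr_sumr [leRHS](bigD1 y) //=.
  rewrite ler_wpDl ?mulr_ge0 ?mass_observe_ge0 //.
  by apply: ler_sum => y' _; apply: le_B; exact: nonneg_observe.
have := subsol mu a mu0 adm_a; rewrite (bigD1 y) //=; move: others; lra.
Qed.

End Reach.

Lemma letter0_feasible (mx my ms : nat) (x : 'I_mx.+1) (s : 'I_ms.+1) :
  feasible ms s x (ord0 : 'I_my.+1) = (x <= s)%N.
Proof. by rewrite /feasible addn0; have := ltn_ord s; lia. Qed.

Lemma letter0_forced (mx my ms : nat) (y : 'I_my.+1) :
  feasible ms (ord_max : 'I_ms.+1) (ord0 : 'I_mx.+1) y -> y = ord0.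
Proof. by rewrite /feasible /= => feas; apply/val_inj => /=; lia. Qed.

Section OtherLetter.
Variables (mx my ms : nat).
Hypotheses (mx_gt0 : (0 < mx)%N) (le_mx_my : (mx <= my)%N) (ms_gt0 : (0 < ms)%N).
Implicit Types (x : 'I_mx.+1) (y : 'I_my.+1) (s : 'I_ms.+1).

Lemma unforced_letter y x s :
  ~ [/\ y = 0%N :> nat, x = 0%N :> nat & s = ms :> nat] ->
  ~ [/\ y = my :> nat, x = my :> nat & s = 0%N :> nat] -> unforced y x s.
Proof.
move=> not_low not_high; have lt_x := ltn_ord x; have lt_s := ltn_ord s.
have other n : (n <= my)%N -> n <> y -> feasible ms s x n -> unforced y x s.
  move=> le_n n_y feas; exists (inord n); rewrite ?inordK //.
  by apply/eqP => /(congr1 val); rewrite /= inordK.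
have [yx|/eqP yx] := eqVneq (y : nat) x; last by apply: (other x); rewrite /feasible; lia.
have [down|no_down] := boolP ((0 < x) && (0 < s))%N.
  by apply: (other x.-1); rewrite /feasible; lia.
have [up|no_up] := boolP ((x < my) && (s < ms))%N.
  by apply: (other x.+1); rewrite /feasible; lia.
exfalso; have [x0|x_gt0] := posnP x; first by apply: not_low; split; lia.
by apply: not_high; split; lia.
Qed.

End OtherLetter.

Lemma positive_entries_lower_bound (R : realType) n (Q : 'M[R]_n.+1) :
  stochastic Q -> exists q0 : R, [/\ 0 < q0, q0 <= 1 & forall i j, Q i j != 0 -> q0 <= Q i j].
Proof.
move=> stoQ; pose entry (ij : 'I_n.+1 * 'I_n.+1) := if Q ij.1 ij.2 == 0 then 1 else Q ij.1 ij.2.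
have entry0 ij : 0 < entry ij.
  by rewrite /entry; case: ifP => // /negbT qn; rewrite lt0r qn stochastic_ge0.
have entry1 ij : entry ij <= 1 by rewrite /entry; case: ifP => // _; rewrite stochastic_le1.
exists (\prod_ij entry ij); split; first by apply: prodr_gt0.
  by apply: prodr_ile1 => ij; rewrite entry1 ltW.
move=> i j qn; rewrite (bigD1 (i, j)) //= {1}/entry /= (negbTE qn).
by rewrite ler_piMr ?stochastic_ge0 //; apply: prodr_ile1 => ij; rewrite entry1 ltW.
Qed.

Section Feeding.
Variables (R : realType) (mx my ms : nat).
Local Notation X := 'I_mx.+1.
Local Notation Y := 'I_my.+1.
Local Notation S := 'I_ms.+1.
Implicit Types (u : X) (z : Y) (s : S) (flow mu : X -> S -> R) (c : R).

Definition feeds z u s := [exists s0 : S, (s0 + z == s + u)%N].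

Lemma inflow_feeds z mu u s : inflow z mu u s != 0 -> feeds z u s.
Proof. by move=> /inflow_neq0[s0 e _]; apply/existsP; exists s0; rewrite e. Qed.

(* The weights from which letter [z] produces a prescribed inflow. *)
Definition pullback z flow : X -> S -> R := fun u s => at_next_charge z u (flow u) s.

Lemma inflow_pullback z flow u s : (~~ feeds z u s -> flow u s = 0) ->
  inflow z (pullback z flow) u s = flow u s.
Proof.
have [/existsP[s0 /eqP e] _|not_fed ->] := boolP (feeds z u s) => //.
  by rewrite (inflow_next _ e) /pullback (at_next_chargeE _ e).
by apply/eqP; apply: contraNT not_fed => /inflow_feeds.
Qed.

Lemma nonneg_pullback z flow : nonneg flow -> nonneg (pullback z flow).
Proof. by move=> flow0 u s; exact: sumr_ge0. Qed.

Lemma pullback_supports z flow : supports_letter z (pullback z flow).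
Proof.
by move=> u s; apply: contraNT => infeas; rewrite /pullback at_next_charge_infeasible.
Qed.

Lemma pullback_le z flow c u s : 0 <= c -> (forall u s, flow u s <= c) ->
  pullback z flow u s <= c.
Proof.
move=> c0 le_c; have [/feasibleP[s' e]|infeas] := boolP (feasible ms s u z).
  by rewrite /pullback (at_next_chargeE _ e).
by rewrite /pullback at_next_charge_infeasible.
Qed.

End Feeding.

Section LowerBound.
Variables (R : realType) (mx my ms : nat) (Q : 'M[R]_mx.+1).
Local Notation X := 'I_mx.+1.
Local Notation Y := 'I_my.+1.
Local Notation S := 'I_ms.+1.
Implicit Types (u x : X) (s : S) (y z : Y) (mu w b h : X -> S -> R) (B c : R).
Variables (v : (X -> S -> R) -> R) (K : R).
Hypotheses (stoQ : stochastic Q) (mx_gt0 : (0 < mx)%N) (le_mx_my : (mx <= my)%N).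
Hypotheses (ms_gt0 : (0 < ms)%N) (K_ge0 : 0 <= K) (reach : reach_bound my Q v K).

Local Notation V := (perspective v).
Local Notation ones := (fun (_ : X) (_ : S) => 1 : R).
Local Notation letter0 := (ord0 : Y).

Definition reach_const : R := `|V ones| + K * mass ones.

Lemma mass_ones_ge0 : 0 <= mass ones. Proof. by apply: mass_ge0 => x s; exact: ler01. Qed.

Lemma reach_const_ge0 : 0 <= reach_const.
Proof. by rewrite addr_ge0 // mulr_ge0 // mass_ones_ge0. Qed.

Lemma reach_from_ones y w c : nonneg w -> (forall x s, w x s <= c) -> supports_letter y w ->
  (forall x s, w x s != c -> unforced y x s) -> - (reach_const * c) <= V (advance Q y w).
Proof.
move=> w0 w_le w_feas w_unforced; have c0 := le_trans (w0 ord0 ord0) (w_le ord0 ord0).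
have [c_eq0|c_n0] := eqVneq c 0.
  rewrite c_eq0 mulr0 oppr0 perspective_mass0 // mass_advance // /mass big1 // => x _.
  by rewrite big1 // => s _; apply/le_anti; rewrite w0 -c_eq0 w_le.
have c_gt0 : 0 < c by rewrite lt0r c_n0.
pose h : X -> S -> R := fun x s => w x s / c.
have weigh_h : weigh h (scale c ones) = w.
  by apply/funext => x; apply/funext => s; rewrite /weigh /scale mulr1 divfK.
have h_weight : letter_weight y h.
  apply: letter_weightI => [x s|x s|x s|x s]; rewrite /h.
  - by rewrite divr_ge0.
  - by rewrite ler_pdivrMr // mul1r.
  - by rewrite mulf_eq0 => /norP[/w_feas].
  by rewrite -(divff c_n0) (can_eq (divfK c_n0)) => /w_unforced.
have ones0 : nonneg (scale c ones) by apply: nonneg_scale => // x s; exact: ler01.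
have := reach ones0 h_weight; rewrite weigh_h perspective_scale mass_scale; apply: le_trans.
rewrite [K * _]mulrCA -mulrBr mulrC -mulrN ler_wpM2l // /reach_const opprD lerD2r.
exact: lerNnormlW.
Qed.

Lemma noncorner_value_ge y w : nonneg w -> supports_letter y w -> y != 0%N :> nat ->
  ~~ ((y == my :> nat) && (mx == my)) -> - (reach_const * mass w) <= V (advance Q y w).
Proof.
move=> w0 w_feas /eqP y_n0 not_top; apply: reach_from_ones => // x s; first exact: le_mass.
move=> _; apply: unforced_letter => // -[y_my x_my _] //.
by move: not_top; rewrite y_my eqxx /=; have := ltn_ord x; lia.
Qed.

(* In the corner state [(0, ms)] the letter 0 is forced, so a measure [mu] can be
   weighed down to [w] for the letter 0 exactly when it dominates [w] with equality at
   the corner. *)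
Definition dominated B w := exists mu,
  [/\ forall x s, w x s <= mu x s, mu ord0 ord_max = w ord0 ord_max,
      mass mu <= B * mass w & - (B * mass w) <= V mu].

Lemma dominated_mono B B' w : nonneg w -> B <= B' -> dominated B w -> dominated B' w.
Proof.
move=> w0 le_B [mu [w_le corner mass_le V_ge]]; exists mu.
have le_m : B * mass w <= B' * mass w by rewrite ler_wpM2r ?mass_ge0.
by split=> //; [exact: le_trans le_m | apply: le_trans V_ge; rewrite lerN2].
Qed.

Lemma letter0_weightI b : nonneg b -> (forall x s, b x s <= 1) -> supports_letter letter0 b ->
  b ord0 ord_max = 1 -> letter_weight letter0 b.
Proof.
move=> b0 b1 b_feas b_corner; apply: letter_weightI => // x s bn.
apply: unforced_letter => // -[/= y_eq x0 s_max]; last by lia.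
by move/eqP: bn; apply; rewrite -b_corner; congr (b _ _); exact: val_inj.
Qed.

Lemma letter0_weight_corner b : letter_weight letter0 b -> b ord0 ord_max = 1.
Proof. by move/letter_weight_forced; apply=> y; exact: letter0_forced. Qed.

Lemma dominated_value B w : nonneg w -> supports_letter letter0 w -> dominated B w ->
  - ((1 + K) * B * mass w) <= V (advance Q letter0 w).
Proof.
move=> w0 w_feas [mu [w_le corner mass_le V_ge]].
have mu0 : nonneg mu by move=> x s; exact: le_trans (w_le x s).
pose h x s := if mu x s == 0 then ((x == ord0) && (s == ord_max))%:R else w x s / mu x s.
have weigh_h : weigh h mu = w.
  apply/funext => x; apply/funext => s; rewrite /weigh /h.
  have [e|mu_n0] := eqVneq (mu x s) 0; last by rewrite divfK.
  by rewrite e mulr0; apply/le_anti; rewrite w0 -e w_le.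
have h_weight : letter_weight letter0 h.
  apply: letter0_weightI => [x s|x s|x s|]; rewrite /h.
  - by case: ifP => _; [exact: ler0n | rewrite divr_ge0].
  - case: ifP => [_|/negbT mu_n0]; first by case: (_ && _).
    by rewrite ler_pdivrMr ?mul1r // lt0r mu_n0 mu0.
  - case: ifP => _; last by rewrite mulf_eq0 => /norP[/w_feas].
    by case: (x =P ord0) => [-> _|]; rewrite ?letter0_feasible ?eqxx.
  by case: ifP => [_|/negbT mu_n0]; [rewrite !eqxx | rewrite -corner divff].
have := reach mu0 h_weight; rewrite weigh_h; apply: le_trans.
have : K * mass mu <= K * (B * mass w) by rewrite ler_wpM2l.
by rewrite mulrDl mulrDl mul1r mulrA; move: V_ge; lra.
Qed.

Lemma dominated_start p : is_pmfXS p -> exists2 B, 0 <= B &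
  forall b, letter_weight letter0 b -> dominated B (weigh b p).
Proof.
move=> pmf_p; have p0 := pmf_nonneg pmf_p.
have [p_corner|p_corner] := eqVneq (p ord0 ord_max) 0.
  pose punctured x s : R := if (x == ord0) && (s == ord_max) then 0 else 1.
  exists (mass punctured + `|V punctured|).
    by rewrite addr_ge0 // mass_ge0 // => x s; rewrite /punctured; case: ifP.
  move=> b b_weight; have w0 := nonneg_weigh (nonneg_letter_weight b_weight) p0.
  have m0 := mass_ge0 w0; exists (scale (mass (weigh b p)) punctured); split.
  - move=> x s; rewrite /scale /punctured; case: ifP => [/andP[/eqP-> /eqP->]|_].
      by rewrite /weigh p_corner !mulr0.
    by rewrite mulr1 le_mass.
  - by rewrite /scale /punctured !eqxx /weigh p_corner !mulr0.
  - by rewrite mass_scale mulrC ler_wpM2r // lerDl.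
  rewrite perspective_scale mulrC -mulrN ler_wpM2l // opprD.
  apply: le_trans (lerNnormlW (lexx _)); rewrite gerDr oppr_le0 mass_ge0 // => x s.
  by rewrite /punctured; case: ifP.
have pc_gt0 : 0 < p ord0 ord_max by rewrite lt0r p_corner p0.
exists ((1 + `|v p|) / p ord0 ord_max); first by rewrite divr_ge0 // addr_ge0.
move=> b b_weight; have w0 := nonneg_weigh (nonneg_letter_weight b_weight) p0.
have mass_ge : 1 + `|v p| <= (1 + `|v p|) / p ord0 ord_max * mass (weigh b p).
  rewrite mulrAC ler_pdivlMr // ler_wpM2l ?addr_ge0 //.
  by have := le_mass ord0 ord_max w0; rewrite /weigh (letter0_weight_corner b_weight) mul1r.
exists p; split.
- by move=> x s; rewrite ler_piMl // (letter_weight_le1 _ _ b_weight).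
- by rewrite /weigh (letter0_weight_corner b_weight) mul1r.
- by rewrite pmf_mass //; apply: le_trans mass_ge; rewrite lerDl.
rewrite perspective_pmf // lerNl; apply: le_trans mass_ge.
by rewrite -normrN (le_trans (ler_norm _)) // lerDr.
Qed.

Variable q0 : R.
Hypotheses (q0_gt0 : 0 < q0) (q0_le1 : q0 <= 1) (q0_le : forall i j, Q i j != 0 -> q0 <= Q i j).

Definition steer_const : R := (reach_const + mass ones) / q0.

Lemma steer_const_ge0 : 0 <= steer_const.
Proof.
apply: divr_ge0; last exact: ltW.
by apply: addr_ge0; [exact: reach_const_ge0 | exact: mass_ones_ge0].
Qed.

(* Every inflow is full, except that into charge [ms] from the demands [u] that can feed
   the corner: there it is prescribed by [tau]. *)
Definition steer_flow z (tau : X -> R) c : X -> S -> R := fun u s =>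
  if feeds z u s then if (s == ord_max) && (Q u ord0 != 0) then tau u else c else 0.

Section Steer.
Variables (w : X -> S -> R) (z : Y) (tau : X -> R).
Hypotheses (w_ge0 : nonneg w) (z_neq0 : z != 0%N :> nat) (tau_ge0 : forall u, 0 <= tau u).
Hypothesis tau_feeds : forall u, tau u != 0 -> Q u ord0 != 0 /\ feeds z u (ord_max : S).
Hypothesis tau_corner : \sum_u tau u * Q u ord0 = w ord0 ord_max.

Let c : R := mass w / q0.
Let flow := steer_flow z tau c.

Let c_ge0 : 0 <= c. Proof. by rewrite divr_ge0 ?mass_ge0 // ltW. Qed.

Let tau_le u : tau u <= c.
Proof.
have [->|/tau_feeds[qn _]] := eqVneq (tau u) 0; first exact: c_ge0.
rewrite ler_pdivlMr //; apply: (@le_trans _ _ (tau u * Q u ord0)).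
  by rewrite ler_wpM2l // q0_le.
apply: (@le_trans _ _ (w ord0 ord_max)); last exact: le_mass.
rewrite -tau_corner; apply: (ler_sum_term (F := fun u => tau u * Q u ord0)) => u'.
by rewrite mulr_ge0 // stochastic_ge0.
Qed.

Let flow_ge0 : nonneg flow.
Proof. by move=> u s; rewrite /flow /steer_flow; case: ifP => // _; case: ifP. Qed.

Let flow_le u s : flow u s <= c.
Proof. by rewrite /flow /steer_flow; case: ifP => // _; case: ifP. Qed.

Let steered := advance Q z (pullback z flow).

Let steeredE x s : steered x s = \sum_u flow u s * Q u x.
Proof.
apply: eq_bigr => u _; rewrite inflow_pullback //.
by rewrite /flow /steer_flow => /negbTE ->.
Qed.

Let steered_value_ge : - (reach_const * c) <= V steered.
Proof.
apply: reach_from_ones => [|u s||u s]; first exact: nonneg_pullback.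
- exact: pullback_le.
- exact: pullback_supports.
have [feas|infeas] := boolP (feasible ms s u z); last first.
  exists (hold_letter my u s); last exact: hold_letter_feasible.
  by apply: contraNneq infeas => <-; exact: hold_letter_feasible.
have [s' e] := feasibleP _ _ _ feas; rewrite /pullback (at_next_chargeE _ e) => flow_n.
apply: unforced_letter => // -[z_eq u_eq s_eq]; first by move: z_neq0; rewrite z_eq.
move/eqP: flow_n; apply; rewrite /flow /steer_flow.
have -> : feeds z u s' by apply/existsP; exists s; apply/eqP.
by case: eqP => // es; move: e; rewrite es /=; lia.
Qed.

Let steered_corner : steered ord0 ord_max = w ord0 ord_max.
Proof.
rewrite steeredE -tau_corner; apply: eq_bigr => u _; rewrite /flow /steer_flow eqxx /=.
have [->|qn] := eqVneq (Q u ord0) 0; first by rewrite !mulr0.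
case: ifP => // /negbT not_fed; suff -> : tau u = 0 by [].
by apply/eqP; apply: contraNT not_fed => /tau_feeds[].
Qed.

Let steered_full u x s : Q u x != 0 -> feeds z u s -> (s != ord_max) || (Q u ord0 == 0) ->
  w x s <= steered x s.
Proof.
move=> qn fed full; apply: (@le_trans _ _ (c * Q u x)).
  apply: (@le_trans _ _ (mass w)); first exact: le_mass.
  by rewrite -[leLHS](divfK (lt0r_neq0 q0_gt0)) ler_wpM2l // q0_le.
rewrite steeredE; have -> : c = flow u s.
  by rewrite /flow /steer_flow fed -[_ && _]negbK negb_and negbK full.
apply: (ler_sum_term (F := fun u => flow u s * Q u x)) => u'.
by rewrite mulr_ge0 // stochastic_ge0.
Qed.

Let steered_top x : \sum_u tau u * Q u x <= steered x ord_max.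
Proof.
rewrite steeredE; apply: ler_sum => u _; rewrite ler_wpM2r ?stochastic_ge0 //.
have [->//|/tau_feeds[qn fed]] := eqVneq (tau u) 0.
by rewrite /flow /steer_flow fed eqxx qn.
Qed.

Lemma steer_dominated :
  (forall x s, w x s != 0 -> s != ord_max -> exists2 u, Q u x != 0 & feeds z u s) ->
  (forall x, w x ord_max != 0 ->
     (exists u, [/\ Q u ord0 = 0, Q u x != 0 & feeds z u (ord_max : S)]) \/
     w x ord_max <= \sum_u tau u * Q u x) ->
  dominated steer_const w.
Proof.
move=> low top; exists steered; split => //.
- move=> x s; have [->|wn] := eqVneq (w x s) 0.
    by rewrite nonneg_advance //; exact: nonneg_pullback.
  have [es|sn] := eqVneq s ord_max; last first.
    by have [u qn fed] := low x s wn sn; apply: (steered_full qn fed); rewrite sn.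
  rewrite es in wn *; have [[u [e qn fed]]|w_le] := top x wn; last exact: le_trans w_le _.
  by apply: (steered_full qn fed); rewrite e !eqxx.
- rewrite mass_advance //; last exact: pullback_supports.
  apply: (@le_trans _ _ (mass (scale c ones))).
    by apply: ler_mass => x s; rewrite /scale mulr1; exact: pullback_le.
  rewrite mass_scale /c /steer_const mulrAC [leRHS]mulrAC ler_pM2r ?invr_gt0 // mulrC.
  by rewrite ler_wpM2r ?mass_ge0 // lerDr reach_const_ge0.
apply: le_trans steered_value_ge; rewrite lerN2 /c /steer_const mulrA [leRHS]mulrAC.
rewrite ler_pM2r ?invr_gt0 //.
by rewrite ler_wpM2r ?mass_ge0 // lerDl mass_ones_ge0.
Qed.

End Steer.

Lemma weigh_letter0_le b mu x s : letter_weight letter0 b -> weigh b mu x s != 0 ->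
  (x <= s)%N /\ mu x s != 0.
Proof.
by move=> b_weight; rewrite mulf_eq0 => /norP[/(letter_weight_supports b_weight)];
   rewrite letter0_feasible.
Qed.

(* Every state that letter [y] feeds must also be fed by letter [z]. *)
Lemma advance_dominated y z mu b : nonneg mu -> letter_weight letter0 b ->
  z != 0%N :> nat ->
  (forall x u s, (x <= s)%N -> Q u x != 0 -> feeds y u s ->
     exists u', [/\ Q u' x != 0, feeds z u' s & s = ord_max -> u' = u]) ->
  dominated steer_const (weigh b (advance Q y mu)).
Proof.
move=> mu0 b_weight z_n0 refeed.
have b0 := nonneg_letter_weight b_weight.
pose tau u := if Q u ord0 == 0 then 0 else inflow y mu u ord_max.
apply: (@steer_dominated _ z tau) => //.
- exact/nonneg_weigh/nonneg_advance.
- by move=> u; rewrite /tau; case: ifP => // _; exact: inflow_ge0.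
- move=> u; rewrite /tau; have [_|qn in_n0] := eqVneq (Q u ord0) 0; first by rewrite eqxx.
  by have [u' [_ fed <-]] := refeed ord0 u ord_max isT qn (inflow_feeds in_n0).
- rewrite /weigh (letter0_weight_corner b_weight) mul1r; apply: eq_bigr => u _.
  by rewrite /tau; case: eqP => // ->; rewrite !mulr0.
- move=> x s /(weigh_letter0_le b_weight)[le_xs /advance_neq0[u qn in_n0]] _.
  by have [u' [qn' fed _]] := refeed x u s le_xs qn (inflow_feeds in_n0); exists u'.
move=> x /(weigh_letter0_le b_weight)[le_xs _].
have [[u [q0u qn in_n0]]|no_full] :=
    pselect (exists u, [/\ Q u ord0 = 0, Q u x != 0 & inflow y mu u ord_max != 0]).
  left; exists u; split=> //.
  by have [u' [_ fed <-]] := refeed x u ord_max le_xs qn (inflow_feeds in_n0).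
right; apply: (@le_trans _ _ (advance Q y mu x ord_max)).
  by rewrite ler_piMl ?nonneg_advance // (letter_weight_le1 _ _ b_weight).
apply: ler_sum => u _; rewrite /tau; case: eqP => [q0u|//]; rewrite mul0r.
have [->|qn] := eqVneq (Q u x) 0; first by rewrite mulr0.
have [->|in_n0] := eqVneq (inflow y mu u ord_max) 0; first by rewrite mul0r.
by exfalso; apply: no_full; exists u.
Qed.

Definition quick_return := Q ord0 ord0 = 0 \/
  exists u, [/\ (0 < u)%N, (u <= ms.+1)%N & Q u ord0 != 0].

(* The letter 1 feeds every state that the letter 0 feeds, except [(0, 0)]. *)
Lemma letter1_refeeds : quick_return -> exists2 z : Y, z = 1%N :> nat &
  forall x u s, (x <= s)%N -> Q u x != 0 -> feeds letter0 u s ->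
    exists u', [/\ Q u' x != 0, feeds z u' s & s = ord_max -> u' = u].
Proof.
move=> return0; exists (inord 1); first by rewrite inordK //; lia.
move=> x u s le_xs qn /existsP[s0 /eqP /= e]; have lt_s0 := ltn_ord s0.
have feed1 u' : (0 < s + u' <= ms.+1)%N -> feeds (inord 1 : Y) u' s.
  move=> su; apply/existsP; exists (inord (s + u').-1).
  by rewrite !inordK; lia.
have [su0|su] := posnP (s + u)%N; last by exists u; split=> //; apply: feed1; lia.
have x0 : x = ord0 by apply/val_inj => /=; lia.
have u0 : u = ord0 by apply/val_inj => /=; lia.
rewrite x0 u0 in qn *; case: return0 => [q00|[u' [u'_gt0 u'_le qn']]].
  by rewrite q00 eqxx in qn.
exists u'; split=> [//||s_max]; first by apply: feed1; lia.
by move: su0; rewrite s_max /=; lia.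
Qed.

Lemma dominated_idle w u : nonneg w -> (forall x s, w x s != 0 -> x = ord0) -> (0 < u)%N ->
  Q u ord0 != 0 -> dominated steer_const w.
Proof.
move=> w0 w_idle u_gt0 qn; have le_u := ltn_ord u.
have [z ez] : exists z : Y, z = u :> nat by exists (inord u); rewrite inordK //; lia.
pose tau u' := if u' == u then w ord0 ord_max / Q u ord0 else 0.
have fed s : feeds z u s by apply/existsP; exists s; rewrite ez.
have tau_sum x : \sum_u' tau u' * Q u' x = w ord0 ord_max / Q u ord0 * Q u x.
  rewrite (bigD1 u) //= {1}/tau eqxx big1 ?addr0 // => u' /negbTE un.
  by rewrite /tau un mul0r.
apply: (@steer_dominated _ z tau) => //.
- by rewrite ez -lt0n.
- by move=> u'; rewrite /tau; case: ifP => // _; rewrite divr_ge0 // stochastic_ge0.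
- by move=> u'; rewrite /tau; case: (u' =P u) => [->|_]; rewrite ?eqxx.
- by rewrite tau_sum divfK.
- by move=> x s /w_idle -> _; exists u.
by move=> x wn; right; rewrite (w_idle _ _ wn) tau_sum divfK.
Qed.

Section PullBackWeights.
Variable b : X -> S -> R.
Hypotheses (b_weight : letter_weight letter0 b) (Q00_neq0 : Q ord0 ord0 != 0).

(* The weights before a letter 0 that account for the weights [b] after it. *)
Definition preweight : X -> S -> R := fun x s => Num.min 1 (backward Q letter0 b x s / q0).

Let b_ge0 : nonneg b := nonneg_letter_weight b_weight.

Lemma backward_ge0 x s : 0 <= backward Q letter0 b x s.
Proof. by apply: sumr_ge0 => x' _; rewrite mulr_ge0 ?stochastic_ge0 ?sumr_ge0. Qed.

Lemma preweight_ge0 x s : 0 <= preweight x s.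
Proof. by rewrite le_min ler01 divr_ge0 ?backward_ge0 // ltW. Qed.

Lemma preweight_le1 x s : preweight x s <= 1. Proof. by rewrite ge_min lexx. Qed.

Lemma le_preweight x s x' s' : Q x x' != 0 -> (s + letter0 = s' + x)%N ->
  b x' s' <= preweight x s.
Proof.
move=> qn e; rewrite le_min (letter_weight_le1 _ _ b_weight) /= ler_pdivlMr //.
apply: (@le_trans _ _ (Q x x' * b x' s')); first by rewrite mulrC ler_wpM2r // q0_le.
rewrite -(at_next_chargeE (y := letter0) (b x') e).
apply: (ler_sum_term (F := fun x' => Q x x' * at_next_charge letter0 x (b x') s)) => x1.
by rewrite mulr_ge0 ?stochastic_ge0 ?sumr_ge0.
Qed.

Lemma preweight_corner : preweight ord0 ord_max = 1.
Proof.
apply/le_anti; rewrite preweight_le1 -(letter0_weight_corner b_weight).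
exact: (le_preweight Q00_neq0).
Qed.

Lemma preweight_le x s : preweight x s <= backward Q letter0 b x s / q0.
Proof. by rewrite ge_min lexx orbT. Qed.

Lemma preweight_neq0 x s : preweight x s != 0 ->
  exists x' s', [/\ Q x x' != 0, (s + letter0 = s' + x)%N & b x' s' != 0].
Proof.
apply: contraNP => nE; suff back0 : backward Q letter0 b x s = 0.
  by rewrite /preweight back0 mul0r; apply/eqP/min_idPr; exact: ler01.
rewrite /backward big1 // => x' _.
have [->|qn] := eqVneq (Q x x') 0; first by rewrite mul0r.
rewrite /at_next_charge big1 ?mulr0 // => s' /eqP e; apply/eqP.
by apply: contra_notT nE => bn; exists x', s'.
Qed.

End PullBackWeights.

(* Demands that a run of letters 0 cannot bring back to 0 need enough charge for
   [j] further letters 0. *)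
Definition delayed j b := forall x s, b x s != 0 -> (0 < x)%N -> (x + j <= s)%N.

Lemma delayed0 b : letter_weight letter0 b -> delayed 0 b.
Proof.
move=> b_weight x s /(letter_weight_supports b_weight).
by rewrite letter0_feasible addn0.
Qed.

Lemma advance_letter0_corner mu :
  advance Q letter0 mu ord0 ord_max = mu ord0 ord_max * Q ord0 ord0.
Proof.
rewrite /advance (bigD1 ord0) //= big1 ?addr0 => [|u un].
  by congr (_ * _); apply: inflow_next.
rewrite /inflow big_pred0 ?mul0r // => s.
by apply/negbTE; move: un; rewrite -val_eqE /=; have := ltn_ord s; lia.
Qed.

Section Postpone.
Variables (mu h b : X -> S -> R) (j : nat).
Hypotheses (mu_ge0 : nonneg mu) (h_weight : letter_weight letter0 h).
Hypotheses (b_weight : letter_weight letter0 b) (b_delayed : delayed j b).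
Hypothesis Q00_neq0 : Q ord0 ord0 != 0.
Hypothesis no_quick_return : forall u, (0 < u)%N -> (u <= ms.+1)%N -> Q u ord0 = 0.

Let h' := weigh h (preweight b).

Let h_ge0 : nonneg h := nonneg_letter_weight h_weight.

Lemma postponed_weight : letter_weight letter0 h'.
Proof.
apply: letter0_weightI => [|x s||].
- by apply: nonneg_weigh => // x s; exact: preweight_ge0.
- by rewrite mulr_ile1 ?preweight_ge0 ?preweight_le1 // (letter_weight_le1 _ _ h_weight).
- by move=> x s; rewrite mulf_eq0 => /norP[/(letter_weight_supports h_weight)].
by rewrite /h' /weigh preweight_corner // (letter0_weight_corner h_weight) mulr1.
Qed.

Lemma postponed_delayed : delayed j.+1 h'.
Proof.
move=> x s; rewrite mulf_eq0 => /norP[hn /preweight_neq0[x' [s' [qn /= e bn]]]] x_gt0.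
have le_xs : (x <= s)%N by have := letter_weight_supports h_weight hn; rewrite letter0_feasible.
have x'_gt0 : (0 < x')%N.
  rewrite lt0n; apply: contraNneq qn => x'0; have -> : x' = ord0 by exact: val_inj.
  by rewrite no_quick_return //; have := ltn_ord s; lia.
by have := b_delayed bn x'_gt0; lia.
Qed.

Let w := weigh b (advance Q letter0 (weigh h mu)).
Let w' := weigh h' mu.

Let mass_w'_le : mass w' <= mass w / q0.
Proof.
rewrite /w mass_weigh_advance [leRHS]mulrC -mass_scale; apply: ler_mass => x s.
rewrite /w' /h' /scale /weigh mulrAC.
rewrite [leRHS](_ : _ = h x s * mu x s * (backward Q letter0 b x s / q0)); last by ring.
by rewrite ler_wpM2l ?mulr_ge0 // preweight_le.
Qed.

Let w_le x s : w x s <= advance Q letter0 w' x s.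
Proof.
rewrite /w /weigh mulr_sumr; apply: ler_sum => x1 _.
have [->|qn] := eqVneq (Q x1 x) 0; first by rewrite !mulr0.
rewrite mulrA ler_wpM2r ?stochastic_ge0 // mulr_sumr; apply: ler_sum => s1 /eqP e.
rewrite mulrC /w' /h' /weigh [leRHS]mulrAC ler_wpM2l ?mulr_ge0 //.
exact: le_preweight qn e.
Qed.

Let w_corner : advance Q letter0 w' ord0 ord_max = w ord0 ord_max.
Proof.
rewrite -[RHS]/(b ord0 ord_max * advance Q letter0 (weigh h mu) ord0 ord_max).
rewrite !advance_letter0_corner (letter0_weight_corner b_weight) mul1r.
by rewrite /w' /h' /weigh preweight_corner // mulr1.
Qed.

Lemma dominated_postpone B : 0 <= B -> dominated B w' ->
  dominated (((1 + K) * B + 1) / q0) w.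
Proof.
move=> B0 dom; have B1 : 0 <= (1 + K) * B by rewrite mulr_ge0 // addr_ge0.
have w'0 : nonneg w' by apply: nonneg_weigh => //; exact: nonneg_letter_weight postponed_weight.
have w'_feas : supports_letter letter0 w'.
  exact/weigh_supports/letter_weight_supports/postponed_weight.
have mass_le c : 0 <= c -> c <= (1 + K) * B + 1 ->
    c * mass w' <= ((1 + K) * B + 1) / q0 * mass w.
  move=> c0 c_le; rewrite mulrAC -mulrA; apply: ler_pM => //; exact: mass_ge0.
exists (advance Q letter0 w'); split => //.
  by rewrite mass_advance // -[leLHS]mul1r mass_le // lerDr.
apply: le_trans (dominated_value w'0 w'_feas dom).
by rewrite lerN2 mass_le // lerDl.
Qed.

End Postpone.

Variable p : X -> S -> R.
Hypotheses (pmf_p : is_pmfXS p) (return0 : exists2 u : X, (0 < u)%N & Q u ord0 != 0).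

Let p_ge0 : nonneg p := pmf_nonneg pmf_p.

Lemma delayed_dominated k : ~ quick_return -> (k <= ms)%N ->
  exists2 B, 0 <= B & forall mu b, reachable my Q p mu -> letter_weight letter0 b ->
    delayed (ms - k) b -> dominated B (weigh b mu).
Proof.
move=> slow; have [u u_gt0 qn] := return0.
have Q00_n0 : Q ord0 ord0 != 0 by apply/eqP => q00; apply: slow; left.
have no_return u' : (0 < u')%N -> (u' <= ms.+1)%N -> Q u' ord0 = 0.
  by move=> u'_gt0 u'_le; apply/eqP; apply: contra_notT slow => ?; right; exists u'.
have [B_start B_start0 dom_start] := dominated_start pmf_p.
elim: k => [_|k IH lt_k].
  exists steer_const => [|mu b reach_mu b_weight b_delayed]; first exact: steer_const_ge0.
  have mu0 := reachable_nonneg stoQ p_ge0 reach_mu.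
  apply: (dominated_idle _ _ u_gt0 qn) => [|x s].
    by apply: nonneg_weigh => //; exact: nonneg_letter_weight b_weight.
  rewrite mulf_eq0 => /norP[bn _]; apply/val_inj => /=.
  by case: (posnP x) => // /(b_delayed _ _ bn); have := ltn_ord s; lia.
have [B B0 dom] := IH (ltnW lt_k).
pose B' := ((1 + K) * B + 1) / q0.
have B'0 : 0 <= B' by rewrite divr_ge0 ?(ltW q0_gt0) // addr_ge0 // mulr_ge0 // addr_ge0.
have sc0 := steer_const_ge0.
exists (B_start + steer_const + B') => [|mu b]; first by rewrite !addr_ge0.
case=> [|y {}mu h reach_mu h_weight] b_weight b_delayed.
  apply: (@dominated_mono B_start); [|by rewrite -addrA lerDl addr_ge0 |exact: dom_start].
  exact: nonneg_weigh (nonneg_letter_weight b_weight) p_ge0.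
have mu0 := reachable_nonneg stoQ p_ge0 reach_mu.
have w0 := nonneg_weigh (nonneg_letter_weight h_weight) mu0.
have bw0 := nonneg_weigh (nonneg_letter_weight b_weight) (nonneg_advance stoQ y w0).
have [y0|y_n0] := eqVneq (y : nat) 0%N.
  apply: (@dominated_mono B'); [exact: bw0|by rewrite lerDr addr_ge0|].
  have ey : y = letter0 by exact: val_inj.
  rewrite ey in h_weight *; apply: dominated_postpone => //.
  apply: dom => //; first exact: postponed_weight.
  have -> : (ms - k = (ms - k.+1).+1)%N by lia.
  exact: postponed_delayed.
apply: (@dominated_mono steer_const); [exact: bw0|by rewrite addrAC lerDr addr_ge0|].
by apply: (@advance_dominated y y) => // x u1 s _ qn1 fed; exists u1.
Qed.

Lemma reachable_dominated :
  exists2 B, 0 <= B & forall mu b, reachable my Q p mu -> letter_weight letter0 b ->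
    dominated B (weigh b mu).
Proof.
have [quick|slow] := pselect quick_return; last first.
  have [B B0 dom] := delayed_dominated slow (leqnn ms).
  by exists B => // mu b reach_mu b_weight; apply: dom; rewrite ?subnn //; exact: delayed0.
have [B_start B_start0 dom_start] := dominated_start pmf_p.
have [z ez refeed] := letter1_refeeds quick.
exists (B_start + steer_const) => [|mu b].
  by rewrite addr_ge0 // steer_const_ge0.
case=> [|y {}mu h reach_mu h_weight] b_weight.
  apply: (@dominated_mono B_start); [|by rewrite lerDl steer_const_ge0|exact: dom_start].
  exact: nonneg_weigh (nonneg_letter_weight b_weight) p_ge0.
have w0 := nonneg_weigh (nonneg_letter_weight h_weight) (reachable_nonneg stoQ p_ge0 reach_mu).
apply: (@dominated_mono steer_const); [|by rewrite lerDr|].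
  exact/(nonneg_weigh (nonneg_letter_weight b_weight))/nonneg_advance.
have [y0|y_n0] := eqVneq (y : nat) 0%N; last first.
  by apply: (@advance_dominated y y) => // x u s _ qn fed; exists u.
have ey : y = letter0 by exact: val_inj.
by apply: (@advance_dominated y z); rewrite ?ez // ey.
Qed.

Lemma letter0_value_ge :
  exists2 B, 0 <= B & forall mu h, reachable my Q p mu -> letter_weight letter0 h ->
    - (B * mass (weigh h mu)) <= V (advance Q letter0 (weigh h mu)).
Proof.
have [B B0 dom] := reachable_dominated.
exists ((1 + K) * B) => [|mu h reach_mu h_weight]; first by rewrite mulr_ge0 // addr_ge0.
apply: dominated_value; last exact: dom.
  apply: nonneg_weigh (nonneg_letter_weight h_weight) _.
  exact: (reachable_nonneg stoQ p_ge0 reach_mu).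
exact/weigh_supports/letter_weight_supports.
Qed.

End LowerBound.

Section Reflection.
Variables (R : realType) (mx ms : nat) (Q : 'M[R]_mx.+1).
Local Notation X := 'I_mx.+1.
Local Notation S := 'I_ms.+1.
Implicit Types (x : X) (s : S) (mu h : X -> S -> R).

Definition mirror mu : X -> S -> R := fun x s => mu (rev_ord x) (rev_ord s).

Definition mirror_mx : 'M[R]_mx.+1 := \matrix_(i, j) Q (rev_ord i) (rev_ord j).

Lemma mirrorK : involutive mirror.
Proof. by move=> mu; apply/funext => x; apply/funext => s; rewrite /mirror !rev_ordK. Qed.

Lemma mirror_weigh h mu : mirror (weigh h mu) = weigh (mirror h) (mirror mu).
Proof. by []. Qed.

Lemma nonneg_mirror mu : nonneg mu -> nonneg (mirror mu).
Proof. by move=> mu0 x s; exact: mu0. Qed.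

Lemma mass_mirror mu : mass (mirror mu) = mass mu.
Proof.
rewrite [RHS](reindex_inj rev_ord_inj) /=; apply: eq_bigr => x _.
by rewrite [RHS](reindex_inj rev_ord_inj).
Qed.

Lemma pmf_mirror p : is_pmfXS p -> is_pmfXS (mirror p).
Proof. by move=> [p0 p1]; split=> [x s|]; [exact: p0 | exact: etrans (mass_mirror p) p1]. Qed.

Lemma perspective_mirror v mu :
  perspective (fun p => v (mirror p)) mu = perspective v (mirror mu).
Proof.
rewrite /perspective mass_mirror; congr (_ * v _).
by apply/funext => x; apply/funext => s; rewrite /normalize mass_mirror.
Qed.

Lemma stochastic_mirror : stochastic Q -> stochastic mirror_mx.
Proof.
move=> [Q0 Q1]; split=> [i j|i]; first by rewrite mxE.
rewrite -(Q1 (rev_ord i)) [RHS](reindex_inj rev_ord_inj).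
by apply: eq_bigr => j _; rewrite mxE.
Qed.

Lemma advance_mirror (y : X) mu :
  advance mirror_mx (rev_ord y) (mirror mu) = mirror (advance Q y mu).
Proof.
apply/funext => x'; apply/funext => s'; rewrite /mirror /advance.
rewrite [RHS](reindex_inj rev_ord_inj) /=; apply: eq_bigr => x _; rewrite mxE; congr (_ * _).
rewrite /inflow [RHS](reindex_inj rev_ord_inj) /=; apply: eq_bigl => s.
by have := ltn_ord s; have := ltn_ord x; have := ltn_ord s'; have := ltn_ord y; lia.
Qed.

Lemma mirror_advance (y : X) mu :
  mirror (advance mirror_mx y mu) = advance Q (rev_ord y) (mirror mu).
Proof. by rewrite -[RHS]mirrorK -advance_mirror mirrorK rev_ordK. Qed.

Lemma feasible_mirror x s (y : X) :
  feasible ms (rev_ord s) (rev_ord x) (rev_ord y) = feasible ms s x y.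
Proof.
by rewrite /feasible /=; have := ltn_ord s; have := ltn_ord x; have := ltn_ord y; lia.
Qed.

Lemma letter_weight_mirror (y : X) h : letter_weight y h -> letter_weight (rev_ord y) (mirror h).
Proof.
move=> [a adm_a <-]; exists (fun x s y' => a (rev_ord x) (rev_ord s) (rev_ord y')); last first.
  by apply/funext => x; apply/funext => s; rewrite /likelihood rev_ordK.
move=> x s; have [a0 [a1 a1_feas]] := adm_a (rev_ord x) (rev_ord s); split=> //.
split; first by rewrite -[RHS]a1 [RHS](reindex_inj rev_ord_inj).
rewrite -[RHS]a1_feas [RHS](reindex_inj rev_ord_inj); apply: eq_bigl => y'.
by rewrite feasible_mirror.
Qed.

Lemma reach_bound_mirror (v : (X -> S -> R) -> R) K :
  reach_bound mx Q v K -> reach_bound mx mirror_mx (fun p => v (mirror p)) K.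
Proof.
move=> reach y mu h mu0 h_weight.
rewrite !perspective_mirror -mass_mirror mirror_advance mirror_weigh.
exact: reach (nonneg_mirror mu0) (letter_weight_mirror h_weight).
Qed.

Lemma reachable_mirror p mu : reachable mx Q p mu ->
  reachable mx mirror_mx (mirror p) (mirror mu).
Proof.
elim=> [|y {}mu h _ IH h_weight]; first exact: reachable_start.
rewrite -advance_mirror mirror_weigh; apply: reachable_advance => //.
exact: letter_weight_mirror.
Qed.

End Reflection.

Lemma zero_letter_value_ge (R : realType) (mx my ms : nat) (Q : 'M[R]_mx.+1)
    (v : ('I_mx.+1 -> 'I_ms.+1 -> R) -> R) (K : R) p :
  stochastic Q -> (0 < mx)%N -> (mx <= my)%N -> (0 < ms)%N -> 0 <= K ->
  reach_bound my Q v K -> is_pmfXS p -> (exists2 u, u != ord0 & Q u ord0 != 0) ->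
  exists2 B, 0 <= B & forall mu h, reachable my Q p mu -> letter_weight (ord0 : 'I_my.+1) h ->
    - (B * mass (weigh h mu)) <= perspective v (advance Q (ord0 : 'I_my.+1) (weigh h mu)).
Proof.
move=> stoQ mx_gt0 le_mx_my ms_gt0 K_ge0 reach pmf_p [u un qn].
have [q0 [q0_gt0 q0_le1 q0_le]] := positive_entries_lower_bound stoQ.
have return0 : exists2 u : 'I_mx.+1, (0 < u)%N & Q u ord0 != 0 by exists u; rewrite // lt0n.
exact: (letter0_value_ge stoQ mx_gt0 le_mx_my ms_gt0 K_ge0 reach q0_gt0 q0_le1 q0_le pmf_p).
Qed.

Lemma top_letter_value_ge (R : realType) (mx ms : nat) (Q : 'M[R]_mx.+1)
    (v : ('I_mx.+1 -> 'I_ms.+1 -> R) -> R) (K : R) p :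
  stochastic Q -> (0 < mx)%N -> (0 < ms)%N -> 0 <= K -> reach_bound mx Q v K ->
  is_pmfXS p -> (exists2 u, u != ord_max & Q u ord_max != 0) ->
  exists2 B, 0 <= B & forall mu h, reachable mx Q p mu ->
    letter_weight (ord_max : 'I_mx.+1) h ->
    - (B * mass (weigh h mu)) <= perspective v (advance Q (ord_max : 'I_mx.+1) (weigh h mu)).
Proof.
move=> stoQ mx_gt0 ms_gt0 K_ge0 reach pmf_p [u un qn].
have rev_max : rev_ord ord_max = ord0 :> 'I_mx.+1 by apply/val_inj; rewrite /= subnn.
have rev_0 : rev_ord ord0 = ord_max :> 'I_mx.+1 by rewrite -rev_max rev_ordK.
have return0 : exists2 u, u != ord0 & mirror_mx Q u ord0 != 0.
  by exists (rev_ord u); rewrite ?mxE ?rev_ordK ?rev_0 // -rev_max (inj_eq rev_ord_inj).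
have [B B0 V_ge] := zero_letter_value_ge (stochastic_mirror stoQ) mx_gt0 (leqnn mx) ms_gt0
  K_ge0 (reach_bound_mirror reach) (pmf_mirror pmf_p) return0.
exists B => // mu h mu_reach h_weight.
have := V_ge (mirror mu) (mirror h) (reachable_mirror mu_reach).
rewrite -rev_max -mirror_weigh mass_mirror perspective_mirror mirror_advance mirrorK rev_ordK.
by apply; exact: letter_weight_mirror.
Qed.

Section ValueLowerBound.
Variables (R : realType) (mx my ms : nat) (Q : 'M[R]_mx.+1).
Local Notation X := 'I_mx.+1.
Local Notation Y := 'I_my.+1.
Local Notation S := 'I_ms.+1.
Implicit Types (x : X) (y : Y) (s : S) (mu h w : X -> S -> R).
Variables (v : (X -> S -> R) -> R) (K : R) (p : X -> S -> R).
Hypotheses (stoQ : stochastic Q) (mx_gt0 : (0 < mx)%N) (le_mx_my : (mx <= my)%N) (K_ge0 : 0 <= K).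
Hypotheses (reach : reach_bound my Q v K) (pmf_p : is_pmfXS p).
Hypothesis column : forall i : X, exists2 u : X, u != i & Q u i != 0.

Local Notation V := (perspective v).

Definition value_ge_after (P : Y -> Prop) := exists2 B, 0 <= B & forall y mu h,
  P y -> reachable my Q p mu -> letter_weight y h ->
  - (B * mass (weigh h mu)) <= V (advance Q y (weigh h mu)).

Lemma value_ge_after_or (P1 P2 P : Y -> Prop) : (forall y, P y -> P1 y \/ P2 y) ->
  value_ge_after P1 -> value_ge_after P2 -> value_ge_after P.
Proof.
move=> cover [B1 B10 ge1] [B2 B20 ge2]; exists (B1 + B2) => [|y mu h Py mu_reach h_weight].
  exact: addr_ge0.
have m0 : 0 <= mass (weigh h mu).
  apply/mass_ge0/nonneg_weigh; first exact: nonneg_letter_weight h_weight.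
  exact: (reachable_nonneg stoQ (pmf_nonneg pmf_p) mu_reach).
case: (cover y Py) => [P1y|P2y].
  apply: le_trans (ge1 y mu h P1y mu_reach h_weight).
  by rewrite lerN2 ler_wpM2r // lerDl.
apply: le_trans (ge2 y mu h P2y mu_reach h_weight).
by rewrite lerN2 ler_wpM2r // lerDr.
Qed.

Lemma value_ge_no_battery : ms = 0%N -> value_ge_after (fun=> True).
Proof.
move=> ms0; have s0 s : s = ord0 := ord_eq0 s ms0.
have ones0 x0 : nonneg (prod_belief Q x0 (fun _ : S => 1)).
  by apply: nonneg_prod_belief => // s; exact: ler01.
have [B B0 V_le] := perspective_le_finite_family (fun q => - v q) ones0.
exists B => // y mu h _ mu_reach h_weight; set w := weigh h mu.
have w0 : nonneg w.
  apply: nonneg_weigh; first exact: nonneg_letter_weight h_weight.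
  exact: (reachable_nonneg stoQ (pmf_nonneg pmf_p) mu_reach).
have w_supp : supports_letter y w by exact/weigh_supports/letter_weight_supports.
have [m0|/mass_neq0[x [s wn]]] := eqVneq (mass w) 0.
  by rewrite m0 mulr0 oppr0 perspective_mass0 // mass_advance.
have only x1 s1 : w x1 s1 != 0 -> y = x1 :> nat.
  by move=> /w_supp; rewrite /feasible (s0 s1) /=; lia.
have advE : advance Q y w = scale (w x ord0) (prod_belief Q x (fun=> 1)).
  rewrite (advance_known_demand Q (only x s wn)).
    by rewrite -prod_belief_scale; congr prod_belief; apply/funext => s1; rewrite mulr1 (s0 s1).
  move=> x1 s1 xn; apply/eqP; apply: contraNT xn => /only e.
  by apply/eqP/val_inj; rewrite /= -e; exact: only wn.
rewrite -(mass_advance stoQ w_supp) advE perspective_scale mass_scale mulrCA -mulrN.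
by rewrite ler_wpM2l // lerNl -mulrN; exact: V_le.
Qed.

Section Battery.
Hypothesis ms_gt0 : (0 < ms)%N.

Lemma value_ge_noncorner : value_ge_after (fun y => y <> ord0 /\ ~ (y = ord_max /\ mx = my)).
Proof.
exists (reach_const v K) => [|y mu h [y_n0 y_ntop] mu_reach h_weight].
  exact: reach_const_ge0.
apply: noncorner_value_ge => //.
- apply: nonneg_weigh; first exact: nonneg_letter_weight h_weight.
  exact: (reachable_nonneg stoQ (pmf_nonneg pmf_p) mu_reach).
- exact/weigh_supports/letter_weight_supports.
- by apply: contra_notN y_n0 => /eqP y0; exact: val_inj.
apply: contra_notN y_ntop => /andP[/eqP y_my /eqP e].
by split=> //; exact: val_inj.
Qed.

Lemma value_ge_zero : value_ge_after (fun y => y = ord0).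
Proof.
have [B B0 V_ge] :=
  zero_letter_value_ge stoQ mx_gt0 le_mx_my ms_gt0 K_ge0 reach pmf_p (column ord0).
by exists B => // y mu h ->; exact: V_ge.
Qed.

Lemma value_ge_top : value_ge_after (fun y => y = ord_max /\ mx = my).
Proof.
have [e|ne] := eqVneq mx my; last by exists 0 => // y mu h [_ /eqP]; rewrite (negbTE ne).
rewrite /value_ge_after; move: reach; rewrite -e => reach_mx.
have [B B0 V_ge] := top_letter_value_ge stoQ mx_gt0 ms_gt0 K_ge0 reach_mx pmf_p (column ord_max).
by exists B => // y mu h [-> _]; exact: V_ge.
Qed.

End Battery.

Lemma value_ge_all : value_ge_after (fun=> True).
Proof.
have [ms0|ms_gt0] := posnP ms; first exact: value_ge_no_battery.
have corner := value_ge_after_or (fun y => id) (value_ge_zero ms_gt0) (value_ge_top ms_gt0).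
apply: (value_ge_after_or _ (value_ge_noncorner ms_gt0) corner) => y _.
by have [|y_n0] := pselect (y = ord0); have [|y_ntop] := pselect (y = ord_max /\ mx = my); tauto.
Qed.

Lemma value_lower_bound : exists2 B, 0 <= B & forall mu, reachable my Q p mu ->
  - (B * mass mu) <= V mu.
Proof.
have [B B0 V_ge] := value_ge_all; exists (B + `|v p|) => [|mu]; first exact: addr_ge0.
case=> [|y {}mu h mu_reach h_weight].
  rewrite pmf_mass // mulr1 perspective_pmf // opprD.
  by apply: le_trans (lerNnormlW (lexx _)); rewrite gerDr oppr_le0.
have h_supp : supports_letter y (weigh h mu).
  exact/weigh_supports/letter_weight_supports.
rewrite mass_advance //; apply: le_trans (V_ge y mu h I mu_reach h_weight).
rewrite lerN2 ler_wpM2r ?lerDl //; apply/mass_ge0/nonneg_weigh.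
  exact: nonneg_letter_weight h_weight.
exact: (reachable_nonneg stoQ (pmf_nonneg pmf_p) mu_reach).
Qed.

End ValueLowerBound.

Lemma trmx_expr (R : comNzRingType) n (A : 'M[R]_n.+1) k : (A ^+ k)^T = A^T ^+ k.
Proof.
elim: k => [|k IH]; first by rewrite !expr0 trmx1.
by rewrite exprS exprSr -IH; exact: trmx_mul.
Qed.

Section Irreducible.
Variables (R : realType) (n : nat).
Hypothesis n_gt0 : (0 < n)%N.
Implicit Type Q : 'M[R]_n.+1.

Lemma irreducible_trmx Q : irreducible Q -> irreducible Q^T.
Proof. by move=> irr i j; have [k] := irr j i; exists k; rewrite -trmx_expr mxE. Qed.

Lemma irreducible_row Q i : irreducible Q -> exists2 j, j != i & Q i j != 0.
Proof.
move=> irr; apply: contrapT => nE.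
have absorbing k j : j != i -> (Q ^+ k) i j = 0.
  elim: k j => [|k IH] j jn; first by rewrite expr0 mxE eq_sym (negbTE jn).
  rewrite exprS mxE big1 // => l _; have [->|ln] := eqVneq l i; first by rewrite IH // mulr0.
  suff -> : Q i l = 0 by rewrite mul0r.
  by apply/eqP; apply: contra_notT nE => qn; exists l.
have [j jn] : exists j : 'I_n.+1, j != i.
  have [->|i_n0] := eqVneq i ord0; last by exists ord0; rewrite eq_sym.
  by exists ord_max; rewrite -val_eqE /= -lt0n.
by have [k] := irr i j; rewrite absorbing // ltxx.
Qed.

Lemma irreducible_column Q i : irreducible Q -> exists2 j, j != i & Q j i != 0.
Proof. by move=> /irreducible_trmx/(irreducible_row i)[j jn]; rewrite mxE; exists j. Qed.

Lemma irreducible_diag_lt1 Q i : stochastic Q -> irreducible Q -> Q i i < 1.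
Proof.
move=> stoQ irr; have [j jn qn] := irreducible_row i irr.
rewrite -(stochastic_sum1 stoQ i) (bigD1 i) //= (bigD1 j) //= ltrDl.
rewrite ltr_wpDr // ?lt0r ?qn ?stochastic_ge0 // sumr_ge0 // => k _.
exact: stochastic_ge0.
Qed.

End Irreducible.

(** * Chain rule for the mutual information *)

Section LogBounds.
Variable R : realType.

Lemma ln_le_subr1 (z : R) : 0 < z -> ln z <= z - 1.
Proof.
by move=> z0; have := @le_ln1Dx R (z - 1); rewrite addrCA subrr addr0; apply; lra.
Qed.

Lemma ln_ge_1subV (z : R) : 0 < z -> 1 - z^-1 <= ln z.
Proof.
move=> z0; have zV0 : 0 < z^-1 by rewrite invr_gt0.
by have := ln_le_subr1 zV0; rewrite lnV ?posrE //; lra.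
Qed.

End LogBounds.

Section MutualInformation.
Variables (R : realType) (A B : finType) (p : A -> B -> R).

Local Notation row a := (\sum_b p a b).
Local Notation col b := (\sum_a p a b).

Lemma MIE : MI p = \sum_a \sum_b p a b * ln (p a b / (row a * col b)).
Proof.
by apply: eq_bigr => a _; apply: eq_bigr => b _; case: eqP => // ->; rewrite mul0r.
Qed.

Lemma MI_reindex (A' B' : finType) (f : A' -> A) (g : B' -> B) :
  bijective f -> bijective g -> MI p = MI (fun a b => p (f a) (g b)).
Proof.
move=> bij_f bij_g; rewrite /MI (reindex f) /=; last exact: onW_bij.
apply: eq_bigr => a _; rewrite (reindex g) /=; last exact: onW_bij.
apply: eq_bigr => b _; rewrite (reindex g) /=; last exact: onW_bij.
by rewrite [\sum_a' p a' _](reindex f) /=; last exact: onW_bij.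
Qed.

Lemma MI_constant_output b0 : (forall a b, b != b0 -> p a b = 0) -> \sum_a row a = 1 ->
  MI p = 0.
Proof.
move=> p_b0 p_sum1; have rowE a : row a = p a b0.
  by rewrite (bigD1 b0) //= big1 ?addr0 // => b; exact: p_b0.
rewrite MIE big1 // => a _; rewrite (bigD1 b0) //= [X in _ + X]big1 => [|b bn]; last first.
  by rewrite (p_b0 a b bn) mul0r.
have -> : col b0 = 1 by rewrite -[RHS]p_sum1; apply: eq_bigr => a' _; rewrite rowE.
rewrite rowE mulr1 addr0; have [->|p_n0] := eqVneq (p a b0) 0; first by rewrite mul0r.
by rewrite divff // ln1 mulr0.
Qed.

Hypothesis p_ge0 : forall a b, 0 <= p a b.

Let le_row a b : p a b <= row a. Proof. exact: ler_sum_term. Qed.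

Let le_col a b : p a b <= col b.
Proof. exact: (ler_sum_term (F := fun a => p a b)). Qed.

Lemma MI_le_card : MI p <= #|A|%:R.
Proof.
rewrite MIE -sum1_card natr_sum; apply: ler_sum => a _.
apply: (@le_trans _ _ (\sum_b p a b / row a)); last first.
  by rewrite -mulr_suml; have [->|row_n0] := eqVneq (row a) 0; rewrite ?mul0r ?divff.
apply: ler_sum => b _; have [->|pn] := eqVneq (p a b) 0; first by rewrite !mul0r.
have p_gt0 : 0 < p a b by rewrite lt0r pn p_ge0.
have row_gt0 := lt_le_trans p_gt0 (le_row a b); have col_gt0 := lt_le_trans p_gt0 (le_col a b).
have ratio_gt0 : 0 < p a b / (row a * col b) by rewrite divr_gt0 // mulr_gt0.
rewrite ler_wpM2l // (le_trans (ln_le_subr1 ratio_gt0)) //.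
apply: (@le_trans _ _ (p a b / (row a * col b))); first by rewrite gerBl.
by rewrite invfM mulrCA ler_piMr ?invr_ge0 ?(ltW row_gt0) // ler_pdivrMr // mul1r.
Qed.

Lemma MI_ge0 : \sum_a row a = 1 -> 0 <= MI p.
Proof.
move=> p_sum1; rewrite MIE.
have centered : \sum_a \sum_b (p a b - row a * col b) = 0.
  under eq_bigr => a _ do rewrite sumrB -mulr_sumr.
  by rewrite sumrB p_sum1 -mulr_suml p_sum1 mul1r exchange_big /= p_sum1 subrr.
rewrite -[leLHS]centered; apply: ler_sum => a _; apply: ler_sum => b _.
have [->|pn] := eqVneq (p a b) 0; first by rewrite mul0r sub0r oppr_le0 mulr_ge0 // sumr_ge0.
have p_gt0 : 0 < p a b by rewrite lt0r pn p_ge0.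
have row_gt0 := lt_le_trans p_gt0 (le_row a b); have col_gt0 := lt_le_trans p_gt0 (le_col a b).
have -> : p a b - row a * col b = p a b * (1 - (p a b / (row a * col b))^-1).
  by field; rewrite !gt_eqF.
by rewrite ler_wpM2l // ln_ge_1subV // divr_gt0 // mulr_gt0.
Qed.

End MutualInformation.

(* One step of a channel with memory: [a] is the past input, [b] the past output, [x] the
   new input, [y] the new output, and [st a b] a statistic of the past. *)
Section ChainRule.
Variables (R : realType) (A B X S Y : finType).
Variables (p : A -> B -> R) (r : A -> X -> R) (k : A -> B -> X -> Y -> R) (st : A -> B -> S).
Hypotheses (p_ge0 : forall a b, 0 <= p a b) (r_ge0 : forall a x, 0 <= r a x).
Hypothesis k_ge0 : forall a b x y, 0 <= k a b x y.
Hypotheses (r_sum1 : forall a, \sum_x r a x = 1) (k_sum1 : forall a b x, \sum_y k a b x y = 1).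

Definition step_mass a b x y : R := p a b * r a x * k a b x y.

Definition extend (ax : A * X) (bY : B * Y) : R := step_mass ax.1 bY.1 ax.2 bY.2.

Definition output_mass b : R := \sum_a p a b.

Definition state_mass b x s : R := \sum_(a | st a b == s) p a b * r a x.

Definition letter_mass b x s y : R := \sum_(a | st a b == s) step_mass a b x y.

Definition next_mass b y : R := \sum_x \sum_s letter_mass b x s y.

Definition info_gain : R := \sum_b \sum_x \sum_s \sum_y letter_mass b x s y *
  ln (letter_mass b x s y * output_mass b / (state_mass b x s * next_mass b y)).

Lemma sum_by_state b (F : A -> R) (G : S -> R) :
  \sum_s (\sum_(a | st a b == s) F a) * G s = \sum_a F a * G (st a b).
Proof.
rewrite [RHS](partition_big (fun a => st a b) predT) //=; apply: eq_bigr => s _.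
by rewrite mulr_suml; apply: eq_bigr => a /eqP <-.
Qed.

Lemma sum_state_charge b (F : A -> R) : \sum_s \sum_(a | st a b == s) F a = \sum_a F a.
Proof. by rewrite [RHS](partition_big (fun a => st a b) predT). Qed.

Lemma next_massE b y : next_mass b y = \sum_a \sum_x step_mass a b x y.
Proof. by rewrite exchange_big /=; apply: eq_bigr => x _; exact: sum_state_charge. Qed.

Lemma sum_letter_mass b x s : \sum_y letter_mass b x s y = state_mass b x s.
Proof. by rewrite exchange_big /=; apply: eq_bigr => a _; rewrite -mulr_sumr k_sum1 mulr1. Qed.

Lemma sum_state_mass b : \sum_x \sum_s state_mass b x s = output_mass b.
Proof.
under eq_bigr => x _ do rewrite sum_state_charge.
by rewrite exchange_big; apply: eq_bigr => a _; rewrite -mulr_sumr r_sum1 mulr1.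
Qed.

Lemma step_mass_ge0 a b x y : 0 <= step_mass a b x y. Proof. by rewrite !mulr_ge0. Qed.

Lemma state_mass_ge0 b x s : 0 <= state_mass b x s.
Proof. by apply: sumr_ge0 => a _; rewrite mulr_ge0. Qed.

Lemma letter_mass_ge0 b x s y : 0 <= letter_mass b x s y.
Proof. by apply: sumr_ge0 => a _; exact: step_mass_ge0. Qed.

Lemma letter_mass_kernel (act : B -> X -> S -> Y -> R) :
  (forall a b x y, k a b x y = act b x (st a b) y) ->
  forall b x s y, letter_mass b x s y = state_mass b x s * act b x s y.
Proof.
move=> kE b x s y; rewrite /letter_mass /state_mass mulr_suml.
by apply: eq_bigr => a /eqP <-; rewrite /step_mass kE.
Qed.

Let ler_sum_cond (I : finType) (P : pred I) (F : I -> R) i :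
  (forall j, 0 <= F j) -> P i -> F i <= \sum_(j | P j) F j.
Proof. by move=> F0 Pi; rewrite (bigD1 i) //= lerDl sumr_ge0. Qed.

Lemma step_mass_factors_gt0 a b x y : 0 < step_mass a b x y ->
  [/\ 0 < p a b, 0 < r a x & 0 < k a b x y].
Proof.
rewrite !lt0r p_ge0 r_ge0 k_ge0 !mulf_eq0 !negb_or => /andP[/andP[/andP[-> ->] ->] _].
by split.
Qed.

Lemma step_mass_totals_gt0 a b x y : 0 < step_mass a b x y ->
  [/\ 0 < output_mass b, 0 < state_mass b x (st a b), 0 < letter_mass b x (st a b) y
    & 0 < next_mass b y].
Proof.
move=> step_gt0; have [p_gt0 r_gt0 k_gt0] := step_mass_factors_gt0 step_gt0.
have letter_gt0 : 0 < letter_mass b x (st a b) y.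
  apply: (lt_le_trans step_gt0).
  by apply: (ler_sum_cond (F := fun a => step_mass a b x y)) => // a'; exact: step_mass_ge0.
split=> //.
- exact/(lt_le_trans p_gt0)/(ler_sum_cond (F := fun a => p a b)).
- apply: (lt_le_trans (mulr_gt0 p_gt0 r_gt0)).
  by apply: (ler_sum_cond (F := fun a => p a b * r a x)) => // a'; rewrite mulr_ge0.
apply: (lt_le_trans letter_gt0).
apply: (@le_trans _ _ (\sum_s letter_mass b x s y)).
  by apply: (ler_sum_term (F := fun s => letter_mass b x s y)) => s; exact: letter_mass_ge0.
apply: (ler_sum_term (F := fun x => \sum_s letter_mass b x s y)) => x'.
by apply: sumr_ge0 => s _; exact: letter_mass_ge0.
Qed.

Lemma MI_extendE : MI extend = MI p + \sum_a \sum_b \sum_x \sum_y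
  step_mass a b x y * ln (k a b x y * output_mass b / next_mass b y).
Proof.
have rowE a x : \sum_bY extend (a, x) bY = (\sum_b p a b) * r a x.
  rewrite -(pair_bigA _ (fun b y => step_mass a b x y)) mulr_suml; apply: eq_bigr => b _.
  by rewrite -mulr_sumr k_sum1 mulr1.
have colE b y : \sum_ax extend ax (b, y) = next_mass b y.
  by rewrite -(pair_bigA _ (fun a x => step_mass a b x y)) next_massE.
have -> : MI extend = \sum_a \sum_x \sum_b \sum_y step_mass a b x y *
    ln (step_mass a b x y / ((\sum_b p a b) * r a x * next_mass b y)).
  rewrite MIE [RHS]pair_bigA; apply: eq_bigr => -[a x] _ /=.
  by rewrite [RHS]pair_bigA; apply: eq_bigr => -[b y] _ /=; rewrite rowE colE.
rewrite MIE -big_split /=; apply: eq_bigr => a _.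
rewrite exchange_big /= -big_split /=; apply: eq_bigr => b _.
have -> : p a b * ln (p a b / ((\sum_b' p a b') * output_mass b)) =
    \sum_x \sum_y step_mass a b x y * ln (p a b / ((\sum_b' p a b') * output_mass b)).
  under [RHS]eq_bigr => x _ do rewrite -mulr_suml /step_mass -mulr_sumr k_sum1 mulr1.
  by rewrite -mulr_suml -mulr_sumr r_sum1 mulr1.
rewrite -big_split /=; apply: eq_bigr => x _; rewrite -big_split /=; apply: eq_bigr => y _.
have [->|step_n0] := eqVneq (step_mass a b x y) 0; first by rewrite !mul0r addr0.
have step_gt0 : 0 < step_mass a b x y by rewrite lt0r step_n0 step_mass_ge0.
have [p_gt0 r_gt0 k_gt0] := step_mass_factors_gt0 step_gt0.
have [out_gt0 _ _ next_gt0] := step_mass_totals_gt0 step_gt0.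
have row_gt0 : 0 < \sum_b' p a b' by apply: lt_le_trans p_gt0 (ler_sum_term _ _).
rewrite -mulrDr -lnM ?posrE ?divr_gt0 ?mulr_gt0 //; congr (_ * ln _).
by rewrite /step_mass; field; rewrite !gt_eqF.
Qed.

Lemma info_gainE : info_gain = \sum_a \sum_b \sum_x \sum_y step_mass a b x y *
  ln (letter_mass b x (st a b) y * output_mass b / (state_mass b x (st a b) * next_mass b y)).
Proof.
rewrite [RHS]exchange_big /=; apply: eq_bigr => b _.
rewrite [RHS]exchange_big /=; apply: eq_bigr => x _.
rewrite exchange_big /= [RHS]exchange_big /=; apply: eq_bigr => y _.
exact: (sum_by_state b (fun a => step_mass a b x y) (fun s => ln (letter_mass b x s y *
  output_mass b / (state_mass b x s * next_mass b y)))).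
Qed.

Lemma sum_averaged_step_mass : \sum_a \sum_b \sum_x \sum_y (step_mass a b x y -
  p a b * r a x * (letter_mass b x (st a b) y / state_mass b x (st a b))) = 0.
Proof.
rewrite exchange_big big1 //= => b _; rewrite exchange_big big1 //= => x _.
under eq_bigr => a _.
  rewrite sumrB -mulr_sumr k_sum1 mulr1 -mulr_sumr -mulr_suml sum_letter_mass; over.
rewrite sumrB -(sum_by_state b (fun a => p a b * r a x)
  (fun s => state_mass b x s / state_mass b x s)) -(sum_state_charge b) -sumrB big1 // => s _.
rewrite -/(state_mass b x s); have [->|state_n0] := eqVneq (state_mass b x s) 0.
  by rewrite mul0r subrr.
by rewrite divff // mulr1 subrr.
Qed.

(* Data processing: [(x, st a b)] is a function of the input, up to the past output. *)
Lemma MI_extend_ge : MI p + info_gain <= MI extend.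
Proof.
rewrite MI_extendE lerD2l info_gainE -subr_ge0 -sumrB -[leLHS]sum_averaged_step_mass.
apply: ler_sum => a _; rewrite -sumrB; apply: ler_sum => b _.
rewrite -sumrB; apply: ler_sum => x _; rewrite -sumrB; apply: ler_sum => y _.
have [->|step_n0] := eqVneq (step_mass a b x y) 0.
  rewrite !mul0r sub0r subrr oppr_le0; apply: mulr_ge0; first exact: mulr_ge0.
  by apply: divr_ge0; [exact: letter_mass_ge0 | exact: state_mass_ge0].
have step_gt0 : 0 < step_mass a b x y by rewrite lt0r step_n0 step_mass_ge0.
have [p_gt0 r_gt0 k_gt0] := step_mass_factors_gt0 step_gt0.
have [out_gt0 state_gt0 letter_gt0 next_gt0] := step_mass_totals_gt0 step_gt0.
rewrite -[leRHS]mulrBr -ln_div ?posrE ?divr_gt0 ?mulr_gt0 //.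
set ratio := (X in ln X).
have ratioE : ratio = k a b x y * state_mass b x (st a b) / letter_mass b x (st a b) y.
  by rewrite /ratio; field; rewrite !gt_eqF.
rewrite [leLHS](_ : _ = step_mass a b x y * (1 - ratio^-1)); last first.
  by rewrite ratioE /step_mass; field; rewrite !gt_eqF.
by rewrite ler_wpM2l ?step_mass_ge0 // ln_ge_1subV // ratioE divr_gt0 // mulr_gt0.
Qed.

Lemma MI_extend_eq (act : B -> X -> S -> Y -> R) :
  (forall a b x y, k a b x y = act b x (st a b) y) -> MI extend = MI p + info_gain.
Proof.
move=> kE; rewrite MI_extendE info_gainE; congr (_ + _).
apply: eq_bigr => a _; apply: eq_bigr => b _; apply: eq_bigr => x _; apply: eq_bigr => y _.
have [->|step_n0] := eqVneq (step_mass a b x y) 0; first by rewrite !mul0r.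
have step_gt0 : 0 < step_mass a b x y by rewrite lt0r step_n0 step_mass_ge0.
have [out_gt0 state_gt0 _ next_gt0] := step_mass_totals_gt0 step_gt0.
rewrite (letter_mass_kernel kE) -kE.
by congr (_ * ln _); field; rewrite !gt_eqF.
Qed.

End ChainRule.

Section ActionInformation.
Variables (R : realType) (mx my ms : nat).
Local Notation X := 'I_mx.+1.
Local Notation Y := 'I_my.+1.
Local Notation S := 'I_ms.+1.
Variable a : X -> S -> Y -> R.
Hypothesis adm_a : admissible a.

Lemma Iact_le_card p : is_pmfXS p -> Iact a p <= #|{: X * S}|%:R.
Proof.
move=> [p0 _]; apply: MI_le_card => xs y.
by rewrite mulr_ge0 //; have [a0 _] := adm_a xs.1 xs.2; exact: a0.
Qed.

Lemma perspective_Iact mu : nonneg mu -> perspective (Iact a) mu =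
  \sum_x \sum_s \sum_y mu x s * a x s y *
    ln (mu x s * a x s y * mass mu / (mu x s * \sum_x' \sum_s' mu x' s' * a x' s' y)).
Proof.
move=> mu0; have [m0|mn] := eqVneq (mass mu) 0.
  rewrite perspective_mass0 // big1 // => x _; rewrite big1 // => s _.
  by rewrite big1 // => y _; rewrite mass_eq0 // !mul0r.
rewrite /perspective /Iact MIE mulr_sumr [RHS]pair_bigA; apply: eq_bigr => -[x s] _ /=.
rewrite mulr_sumr; apply: eq_bigr => y _; set joint := fun x s => mu x s * a x s y.
have rowE : \sum_y' normalize mu x s * a x s y' = mu x s / mass mu.
  by rewrite -mulr_sumr; have [_ [-> _]] := adm_a x s; rewrite mulr1.
have colE : \sum_(xs : X * S) normalize mu xs.1 xs.2 * a xs.1 xs.2 y = mass joint / mass mu.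
  rewrite -(pair_bigA _ (fun x s => normalize mu x s * a x s y)) /= /mass mulr_suml.
  by apply: eq_bigr => x' _; rewrite mulr_suml; apply: eq_bigr => s' _; rewrite mulrAC.
rewrite rowE colE -/(mass joint) mulrA {1}/normalize.
rewrite [mass mu * _]mulrA [mass mu * _]mulrC divfK //.
have [->|joint_n0] := eqVneq (mu x s * a x s y) 0; first by rewrite !mul0r.
have joint0 : nonneg joint.
  by move=> x' s'; rewrite mulr_ge0 //; have [a0 _] := adm_a x' s'; exact: a0.
have mass_n0 : mass joint != 0.
  by apply: contraNneq joint_n0 => /(mass_eq0 x s joint0)/eqP.
have mu_n0 : mu x s != 0 by apply: contraNneq joint_n0 => ->; rewrite mul0r.
by congr (_ * ln _); rewrite /normalize; field; rewrite mn mass_n0 mu_n0.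
Qed.

End ActionInformation.

(** * Trajectories and beliefs under a policy *)

Lemma eq_in_mkseq (Z : Type) (f g : nat -> Z) n : (forall i, (i < n)%N -> f i = g i) ->
  mkseq f n = mkseq g n.
Proof. by move=> fg; apply/eq_in_map => i; rewrite mem_iota => /andP[_ /fg]. Qed.

Lemma take_mkseq (Z : Type) (f : nat -> Z) i n : (i <= n)%N -> take i (mkseq f n) = mkseq f i.
Proof. by move=> le_i; rewrite /mkseq -map_take take_iota (minn_idPl le_i). Qed.

Lemma nth_rcons_lt (Z : Type) (z0 : Z) zs z i : (i < size zs)%N ->
  nth z0 (rcons zs z) i = nth z0 zs i.
Proof. by move=> lt_i; rewrite nth_rcons lt_i. Qed.

Lemma nth_rcons_last (Z : Type) (z0 : Z) zs z n : size zs = n ->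
  nth z0 (rcons zs z) n = z.
Proof. by move=> <-; rewrite nth_rcons ltnn eqxx. Qed.

Lemma take_rcons_le (Z : Type) (zs : seq Z) z i : (i <= size zs)%N ->
  take i (rcons zs z) = take i zs.
Proof. by move=> le_i; rewrite -cats1 takel_cat. Qed.

Section TupleSums.
Variables (R : realType) (X Y S : finType) (T : nat).

Lemma rcons_tuple_bij : bijective (fun b : T.-tuple Y * Y => rcons_tuple b.1 b.2).
Proof.
apply: inj_card_bij => [[ys y] [ys' y'] /= e|].
  by have /rcons_inj[eys ->] := congr1 (fun c => tval c) e; rewrite (val_inj eys).
by rewrite !card_prod !card_tuple expnSr.
Qed.

Lemma rcons_pair_bij :
  bijective (fun a : (T.-tuple X * S) * X => (rcons_tuple a.1.1 a.2, a.1.2)).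
Proof.
apply: inj_card_bij => [[[xs s] x] [[xs' s'] x'] /= e|].
  have /rcons_inj[exs ->] := congr1 (fun c => tval c.1) e.
  by have /= -> := congr1 snd e; rewrite (val_inj exs).
by rewrite !card_prod !card_tuple expnSr; lia.
Qed.

Lemma sum_rcons_tuple (F : T.+1.-tuple Y -> R) :
  \sum_b F b = \sum_(b : T.-tuple Y) \sum_y F (rcons_tuple b y).
Proof.
rewrite (reindex (fun b : T.-tuple Y * Y => rcons_tuple b.1 b.2)) /=; last first.
  exact/onW_bij/rcons_tuple_bij.
by rewrite (pair_bigA _ (fun b y => F (rcons_tuple b y))).
Qed.

Lemma sum_rcons_pair (F : T.+1.-tuple X * S -> R) :
  \sum_a F a = \sum_(a : T.-tuple X * S) \sum_x F (rcons_tuple a.1 x, a.2).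
Proof.
rewrite (reindex (fun a : (T.-tuple X * S) * X => (rcons_tuple a.1.1 a.2, a.1.2))) /=; last first.
  exact/onW_bij/rcons_pair_bij.
by rewrite (pair_bigA _ (fun a x => F (rcons_tuple a.1 x, a.2))).
Qed.

Lemma sum_tuple0 (F : 0.-tuple Y -> R) : \sum_b F b = F [tuple].
Proof. by rewrite (big_pred1 [tuple]) // => b; rewrite (tuple0 b) /= (eqxx [tuple]). Qed.

End TupleSums.

Lemma sum_tuple0_pair (R : realType) (X S : finType) (F : 0.-tuple X * S -> R) :
  \sum_a F a = \sum_s F ([tuple], s).
Proof.
transitivity (\sum_(a : 0.-tuple X * S) F (a.1, a.2)); first by apply: eq_bigr => -[].
by rewrite -(pair_bigA _ (fun xs s => F (xs, s))) /= sum_tuple0.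
Qed.

Section Trajectories.
Variables (R : realType) (mx my ms : nat) (Q : 'M[R]_mx.+1).
Local Notation X := 'I_mx.+1.
Local Notation Y := 'I_my.+1.
Local Notation S := 'I_ms.+1.
Variables (PX1 : X -> R) (PS1 : S -> R) (q : policy R mx my ms).
Implicit Types (xs : seq X) (ys : seq Y) (ss : seq S).

(* The charge at time [t + 1]; meaningful as long as the letters are feasible. *)
Fixpoint charge (s1 : S) xs ys (t : nat) : S :=
  if t is t'.+1 then inord (charge s1 xs ys t' + nth ord0 ys t' - nth ord0 xs t') else s1.

Definition arrival xs (t : nat) : R :=
  if t is t'.+1 then Q (nth ord0 xs t') (nth ord0 xs t) else PX1 (nth ord0 xs 0).

Definition letter_prob (s1 : S) xs ys (t : nat) : R :=
  q t (take t.+1 xs) (mkseq (charge s1 xs ys) t.+1) (take t ys) (nth ord0 ys t).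

Definition trajectory (T : nat) (s1 : S) xs ys : R :=
  PS1 s1 * \prod_(t < T) (arrival xs t * letter_prob s1 xs ys t).

Lemma trajectoryS T s1 xs ys : trajectory T.+1 s1 xs ys =
  trajectory T s1 xs ys * (arrival xs T * letter_prob s1 xs ys T).
Proof. by rewrite /trajectory big_ord_recr /= [LHS]mulrA. Qed.

Lemma charge_rcons s1 xs ys x y t : (t <= size xs)%N -> (t <= size ys)%N ->
  charge s1 (rcons xs x) (rcons ys y) t = charge s1 xs ys t.
Proof.
elim: t => [//|t IH] lt_xs lt_ys /=.
by rewrite (IH (ltnW lt_xs) (ltnW lt_ys)) (nth_rcons_lt _ _ lt_xs) (nth_rcons_lt _ _ lt_ys).
Qed.

Lemma mkseq_charge_rcons s1 xs ys x y n : (n <= (size xs).+1)%N -> (n <= (size ys).+1)%N ->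
  mkseq (charge s1 (rcons xs x) (rcons ys y)) n = mkseq (charge s1 xs ys) n.
Proof. by move=> le_xs le_ys; apply: eq_in_mkseq => i lt_i; rewrite charge_rcons //; lia. Qed.

Lemma trajectory_rcons T s1 xs ys x y : size xs = T -> size ys = T ->
  trajectory T.+1 s1 (rcons xs x) (rcons ys y) = trajectory T s1 xs ys *
    arrival (rcons xs x) T * q T (rcons xs x) (mkseq (charge s1 xs ys) T.+1) ys y.
Proof.
move=> size_xs size_ys; rewrite trajectoryS mulrA; congr (_ * _ * _).
  congr (_ * _); apply: eq_bigr => -[t lt_t] _ /=; congr (_ * _).
    by case: t lt_t => [|t] lt_t /=; rewrite !nth_rcons_lt // ?size_xs // ltnW.
  rewrite /letter_prob mkseq_charge_rcons ?size_xs ?size_ys; try lia.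
  by rewrite !take_rcons_le ?size_xs ?size_ys ?nth_rcons_lt ?size_ys // ltnW.
rewrite /letter_prob mkseq_charge_rcons ?size_xs ?size_ys // nth_rcons_last //.
by rewrite take_oversize ?size_rcons ?size_xs // take_rcons_le ?take_oversize ?size_ys.
Qed.

Hypothesis valid_q : valid_policy q.

Lemma policy_ge0 t xs ss ys y : size xs = t.+1 -> size ss = t.+1 -> size ys = t ->
  0 <= q t xs ss ys y.
Proof. by move=> size_xs size_ss size_ys; have [q0 _] := valid_q size_xs size_ss size_ys. Qed.

Lemma policy_sum1 t xs ss ys : size xs = t.+1 -> size ss = t.+1 -> size ys = t ->
  \sum_y q t xs ss ys y = 1.
Proof. by move=> size_xs size_ss size_ys; have [_ []] := valid_q size_xs size_ss size_ys. Qed.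

Lemma policy_feasible t xs ss ys y : size xs = t.+1 -> size ss = t.+1 -> size ys = t ->
  q t xs ss ys y != 0 -> feasible ms (nth ord0 ss t) (nth ord0 xs t) y.
Proof.
move=> size_xs size_ss size_ys; have [q0 [q1 q1_feas]] := valid_q size_xs size_ss size_ys.
pose admitted (y' : Y) := feasible ms (nth ord0 ss t) (nth ord0 xs t) y'.
by apply: (full_subsum_support (P := admitted)) => //; rewrite q1.
Qed.

Lemma charge_step s1 xs ys t :
  feasible ms (charge s1 xs ys t) (nth ord0 xs t) (nth ord0 ys t) ->
  (charge s1 xs ys t.+1 + nth ord0 xs t = charge s1 xs ys t + nth ord0 ys t)%N.
Proof. by rewrite /feasible => /= feas; rewrite inordK; lia. Qed.

Lemma jointPS T xs ss ys : jointP Q PX1 PS1 q T.+1 xs ss ys =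
  jointP Q PX1 PS1 q T xs ss ys *
  ((if T == 0%N then PS1 (nth ord0 ss 0) * PX1 (nth ord0 xs 0)
    else ((nth ord0 ss T + nth ord0 xs T.-1 == nth ord0 ss T.-1 + nth ord0 ys T.-1)%N)%:R
         * Q (nth ord0 xs T.-1) (nth ord0 xs T))
   * q T (take T.+1 xs) (take T.+1 ss) (take T ys) (nth ord0 ys T)).
Proof. by rewrite /jointP big_ord_recr. Qed.

Lemma jointP_charge N s1 xs ys T : (0 < T <= N)%N -> size xs = N -> size ys = N ->
  jointP Q PX1 PS1 q T xs (mkseq (charge s1 xs ys) N) ys = trajectory T s1 xs ys.
Proof.
move=> T_le size_xs size_ys; elim: T T_le => // T IH T_le; rewrite jointPS trajectoryS.
rewrite take_mkseq; last by lia.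
case: T IH T_le => [_|T IH] T_le.
  rewrite /jointP /trajectory !big_ord0 mul1r mulr1 /= !nth_mkseq; last by lia.
  by rewrite /= !mulrA.
rewrite IH; last by lia.
have [->|traj_n0] := eqVneq (trajectory T.+1 s1 xs ys) 0; first by rewrite !mul0r.
congr (_ * (_ * _)) => /=; rewrite !nth_mkseq; try lia.
suff -> : (charge s1 xs ys T.+1 + nth ord0 xs T == charge s1 xs ys T + nth ord0 ys T)%N.
  by rewrite mul1r.
apply/eqP/charge_step.
move: traj_n0; rewrite trajectoryS !mulf_eq0 !negb_or => /andP[_ /andP[_ /policy_feasible]].
rewrite size_takel ?size_xs; last by lia.
rewrite size_mkseq size_takel ?size_ys; last by lia.
by move=> /(_ erefl erefl erefl); rewrite nth_mkseq // nth_take.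
Qed.

Lemma jointP_support N s1 xs ss ys T : (T <= N)%N ->
  size xs = N -> size ys = N -> size ss = N -> nth ord0 ss 0 = s1 ->
  jointP Q PX1 PS1 q T xs ss ys != 0 ->
  forall i, (i < T)%N -> nth ord0 ss i = charge s1 xs ys i.
Proof.
move=> le_T size_xs size_ys size_ss ss0; elim: T le_T => // T IH lt_T.
rewrite jointPS mulf_eq0 negb_or => /andP[joint_n0 factor_n0] i.
rewrite ltnS leq_eqVlt => /predU1P[->|lt_i]; last by apply: IH => //; lia.
case: T IH lt_T joint_n0 factor_n0 => [|T] IH lt_T joint_n0 factor_n0; first exact: ss0.
have ss_charge j : (j < T.+1)%N -> nth ord0 ss j = charge s1 xs ys j by apply: IH => //; lia.
move: factor_n0; rewrite !mulf_eq0 !negb_or /= => /andP[/andP[transition_n0 _] _].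
have {transition_n0} e : (nth ord0 ss T.+1 + nth ord0 xs T = nth ord0 ss T + nth ord0 ys T)%N.
  by apply/eqP; apply: contraNT transition_n0 => /negbTE ->; rewrite eqxx.
apply/val_inj => /=; rewrite inordK -ss_charge //; first by lia.
by have := ltn_ord (nth ord0 ss T.+1); lia.
Qed.

Lemma jointXS1Y_trajectory T (a : T.-tuple X * S) (ys : T.-tuple Y) : (0 < T)%N ->
  jointXS1Y Q PX1 PS1 q a ys = trajectory T a.2 a.1 ys.
Proof.
move=> T_gt0; case: a => xs s1; rewrite /jointXS1Y /=.
pose charges : T.-tuple S := [tuple of mkseq (charge s1 xs ys) T].
rewrite (bigD1 charges) /=; last by rewrite nth_mkseq.
rewrite big1 ?addr0 => [|ss /andP[/eqP ss0 ss_n]].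
  by rewrite jointP_charge ?size_tuple // T_gt0 leqnn.
apply/eqP; apply: contraNT ss_n => joint_n0; apply/eqP/val_inj => /=.
apply: (@eq_from_nth _ ord0); first by rewrite size_mkseq size_tuple.
move=> i; rewrite size_tuple => lt_i.
by rewrite nth_mkseq // (jointP_support (leqnn T) _ _ _ ss0 joint_n0) ?size_tuple.
Qed.

End Trajectories.

Section Dynamics.
Variables (R : realType) (mx my ms : nat) (Q : 'M[R]_mx.+1).
Local Notation X := 'I_mx.+1.
Local Notation Y := 'I_my.+1.
Local Notation S := 'I_ms.+1.
Variables (PX1 : X -> R) (PS1 : S -> R) (q : policy R mx my ms).
Hypotheses (stoQ : stochastic Q) (pmf_PX1 : is_pmf PX1) (pmf_PS1 : is_pmf PS1).
Hypothesis valid_q : valid_policy q.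

Section AtTime.
Variable T : nat.
Implicit Types (a : T.-tuple X * S) (b : T.-tuple Y) (x : X) (y : Y) (s : S).

Definition law a b : R := trajectory Q PX1 PS1 q T a.2 a.1 b.
Definition arrival_law a x : R := arrival Q PX1 (rcons a.1 x) T.
Definition letter_law a b x y : R :=
  q T (rcons a.1 x) (mkseq (charge a.2 a.1 b) T.+1) b y.
Definition charge_at a b : S := charge a.2 a.1 b T.

(* The belief state after the letters [b], scaled by the probability of [b]. *)
Definition joint_belief b : X -> S -> R := state_mass law arrival_law charge_at b.

Definition joint_letter b x s y : R := letter_mass law arrival_law letter_law charge_at b x s y.

Definition gain : R := info_gain law arrival_law letter_law charge_at.

Lemma arrival_ge0 xs t : 0 <= arrival Q PX1 xs t.
Proof. by case: t => [|t] /=; [case: pmf_PX1 | exact: stochastic_ge0]. Qed.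

Lemma arrival_law_ge0 a x : 0 <= arrival_law a x. Proof. exact: arrival_ge0. Qed.

Lemma arrival_law_sum1 a : \sum_x arrival_law a x = 1.
Proof.
case: a => xs s1; rewrite /arrival_law /arrival.
case: T xs => [|T'] xs /=.
  by under eq_bigr => x _ do rewrite nth_rcons_last ?size_tuple //; case: pmf_PX1.
under eq_bigr => x _ do rewrite nth_rcons_lt ?size_tuple // nth_rcons_last ?size_tuple //.
exact: stochastic_sum1.
Qed.

Lemma letter_law_ge0 a b x y : 0 <= letter_law a b x y.
Proof. by apply: (policy_ge0 valid_q); rewrite ?size_rcons ?size_tuple ?size_mkseq. Qed.

Lemma letter_law_sum1 a b x : \sum_y letter_law a b x y = 1.
Proof. by apply: (policy_sum1 valid_q); rewrite ?size_rcons ?size_tuple ?size_mkseq. Qed.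

Lemma letter_law_feasible a b x y : letter_law a b x y != 0 ->
  feasible ms (charge_at a b) x y.
Proof.
move=> /(policy_feasible valid_q); rewrite size_rcons size_tuple size_mkseq size_tuple.
move=> /(_ erefl erefl erefl); rewrite nth_mkseq //.
by rewrite nth_rcons_last ?size_tuple.
Qed.

Lemma law_ge0 a b : 0 <= law a b.
Proof.
apply: mulr_ge0; first by case: pmf_PS1.
apply: prodr_ge0 => t _; rewrite mulr_ge0 ?arrival_ge0 //; have lt_t := ltn_ord t.
by apply: (policy_ge0 valid_q); rewrite ?size_mkseq // size_takel ?size_tuple // ltnW.
Qed.

#[local] Hint Resolve law_ge0 arrival_law_ge0 letter_law_ge0 : core.
#[local] Hint Resolve arrival_law_sum1 letter_law_sum1 : core.

Lemma nonneg_joint_belief b : nonneg (joint_belief b).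
Proof. by move=> x s; exact: state_mass_ge0. Qed.

Lemma mass_joint_belief b : mass (joint_belief b) = output_mass law b.
Proof. exact: sum_state_mass. Qed.

Lemma joint_letter_ge0 b x s y : 0 <= joint_letter b x s y.
Proof. exact: letter_mass_ge0. Qed.

Lemma sum_joint_letter b x s : \sum_y joint_letter b x s y = joint_belief b x s.
Proof. exact: sum_letter_mass. Qed.

Lemma joint_letter_feasible b y : supports_letter y (fun x s => joint_letter b x s y).
Proof.
move=> x s; apply: contraNT => infeas; rewrite /joint_letter /letter_mass big1 // => a /eqP e.
rewrite /step_mass; have [->|/letter_law_feasible] := eqVneq (letter_law a b x y) 0.
  by rewrite mulr0.
by rewrite e (negbTE infeas).
Qed.

Lemma gain_observe (act : T.-tuple Y -> X -> S -> Y -> R) :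
  (forall b, admissible (act b)) ->
  (forall b x s y, joint_letter b x s y = joint_belief b x s * act b x s y) ->
  gain = \sum_b perspective (Iact (act b)) (joint_belief b).
Proof.
move=> adm_act actE; apply: eq_bigr => b _.
rewrite (perspective_Iact (adm_act b) (nonneg_joint_belief b)) mass_joint_belief.
apply: eq_bigr => x _; apply: eq_bigr => s _; apply: eq_bigr => y _.
rewrite -/(joint_letter b x s y) -/(joint_belief b) actE; congr (_ * ln (_ / (_ * _))).
by apply: eq_bigr => x' _; apply: eq_bigr => s' _; exact: actE.
Qed.

(* The law of the letter given the belief state, extended by holding the charge where
   the belief vanishes. *)
Definition induced_action b x s y : R :=
  if joint_belief b x s == 0 then deterministic R (@hold_letter mx my ms) x s y
  else joint_letter b x s y / joint_belief b x s.

Lemma induced_actionE b x s y :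
  joint_letter b x s y = joint_belief b x s * induced_action b x s y.
Proof.
rewrite /induced_action; have [e|belief_n0] := eqVneq (joint_belief b x s) 0.
  rewrite e mul0r; apply/le_anti; rewrite joint_letter_ge0 andbT -e -sum_joint_letter.
  by apply: (ler_sum_term (F := joint_letter b x s)) => y'; exact: joint_letter_ge0.
by rewrite mulrC divfK.
Qed.

Lemma induced_action_admissible b : (mx <= my)%N -> admissible (induced_action b).
Proof.
move=> le_mx_my x s; rewrite /induced_action.
have [_|belief_n0] := eqVneq (joint_belief b x s) 0.
  exact/deterministic_admissible/hold_letter_feasible.
have sum1 : \sum_y joint_letter b x s y / joint_belief b x s = 1.
  by rewrite -mulr_suml sum_joint_letter divff.
split; first by move=> y; rewrite divr_ge0 ?joint_letter_ge0 ?nonneg_joint_belief.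
split=> //; rewrite -[RHS]sum1 big_mkcond /=; apply: eq_bigr => y _.
case: ifP => // /negbT infeas; suff -> : joint_letter b x s y = 0 by rewrite mul0r.
by apply/eqP; apply: contraNT infeas => /joint_letter_feasible.
Qed.

End AtTime.

Lemma lawS T (a : T.-tuple X * S) (x : X) (b : T.-tuple Y) (y : Y) :
  law (rcons_tuple a.1 x, a.2) (rcons_tuple b y) =
  step_mass (@law T) (@arrival_law T) (@letter_law T) a b x y.
Proof. by rewrite /law /= trajectory_rcons ?size_tuple. Qed.

Lemma MI_lawS T : MI (@law T.+1) = MI (extend (@law T) (@arrival_law T) (@letter_law T)).
Proof.
rewrite (MI_reindex _ (rcons_pair_bij X S T) (rcons_tuple_bij Y T)).
by congr MI; apply/funext => -[a x]; apply/funext => -[b y] /=; exact: lawS.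
Qed.

Lemma MI_law_ge T : MI (@law T) + gain T <= MI (@law T.+1).
Proof.
rewrite MI_lawS; exact: (MI_extend_ge _ (@law_ge0 T) (@arrival_law_ge0 T) (@letter_law_ge0 T)
  (@arrival_law_sum1 T) (@letter_law_sum1 T)).
Qed.

Lemma MI_law_eq T (act : T.-tuple Y -> X -> S -> Y -> R) :
  (forall a b x y, letter_law a b x y = act b x (charge_at a b) y) ->
  MI (@law T.+1) = MI (@law T) + gain T.
Proof.
move=> actE; rewrite MI_lawS; exact: (MI_extend_eq (@law_ge0 T) (@arrival_law_ge0 T)
  (@letter_law_ge0 T) (@arrival_law_sum1 T) (@letter_law_sum1 T) actE).
Qed.

Lemma charge_atS T (a : T.-tuple X * S) (x : X) (b : T.-tuple Y) (y : Y) :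
  charge_at (rcons_tuple a.1 x, a.2) (rcons_tuple b y) = inord (charge_at a b + y - x).
Proof. by rewrite /charge_at /= charge_rcons ?nth_rcons_last ?size_tuple. Qed.

Lemma arrival_lawS T (a : T.-tuple X * S) (x x' : X) :
  arrival_law (rcons_tuple a.1 x, a.2) x' = Q x x'.
Proof.
rewrite /arrival_law /= nth_rcons_lt ?size_rcons ?size_tuple //.
by rewrite nth_rcons_last ?size_tuple // nth_rcons_last // size_rcons size_tuple.
Qed.

Lemma inord_next_charge (s s' : S) (x : X) (y : Y) : feasible ms s x y ->
  (inord (s + y - x) == s') = (s + y == s' + x)%N.
Proof. by rewrite /feasible => feas; rewrite -val_eqE /= inordK; lia. Qed.

Lemma joint_beliefS T (b : T.-tuple Y) (y : Y) :
  joint_belief (rcons_tuple b y) = advance Q y (fun x s => joint_letter b x s y).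
Proof.
apply/funext => x'; apply/funext => s'.
rewrite /joint_belief /state_mass big_mkcond sum_rcons_pair.
under eq_bigr => a _ do under eq_bigr => x _ do rewrite lawS arrival_lawS charge_atS.
rewrite exchange_big /=; apply: eq_bigr => x _; rewrite /inflow mulr_suml [RHS]big_mkcond /=.
rewrite (partition_big (fun a => charge_at a b) predT) //=; apply: eq_bigr => s _.
have [feas|infeas] := boolP (feasible ms s x y).
  under eq_bigr => a /eqP es do rewrite es (inord_next_charge _ feas).
  case: ifP => _; last by rewrite big1.
  by rewrite /joint_letter /letter_mass mulr_suml.
case: ifP => [/eqP e|_]; first by case/feasibleP: infeas; exists s'.
rewrite big1 // => a /eqP es; case: ifP => // _; rewrite /step_mass.
have [->|/letter_law_feasible] := eqVneq (letter_law a b x y) 0; first by rewrite mulr0 mul0r.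
by rewrite es (negbTE infeas).
Qed.

Lemma joint_belief_observe T (act : T.-tuple Y -> X -> S -> Y -> R) :
  (forall b x s y, joint_letter b x s y = joint_belief b x s * act b x s y) ->
  forall b y, joint_belief (rcons_tuple b y) = observe Q (act b) y (joint_belief b).
Proof.
move=> actE b y; rewrite joint_beliefS; congr advance.
by apply/funext => x; apply/funext => s; rewrite actE mulrC.
Qed.

Lemma joint_belief0 (b : 0.-tuple Y) : joint_belief b = (fun x s => PX1 x * PS1 s).
Proof.
apply/funext => x; apply/funext => s.
rewrite /joint_belief /state_mass big_mkcond sum_tuple0_pair.
transitivity (\sum_s1 (if s1 == s then PS1 s1 * PX1 x else 0)).
  by apply: eq_bigr => s1 _; rewrite /law /trajectory big_ord0 mulr1.
by rewrite -big_mkcond big_pred1_eq mulrC.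
Qed.

Lemma pmf_start : is_pmfXS (fun x s => PX1 x * PS1 s).
Proof.
have [PX0 PX_sum] := pmf_PX1; have [PS0 PS_sum] := pmf_PS1.
split=> [x s|]; first by rewrite mulr_ge0.
by under eq_bigr => x _ do rewrite -mulr_sumr PS_sum mulr1.
Qed.

Lemma sum_mass_joint_belief T : \sum_(b : T.-tuple Y) mass (joint_belief b) = 1.
Proof.
elim: T => [|T IH]; first by rewrite sum_tuple0 joint_belief0 pmf_mass //; exact: pmf_start.
rewrite sum_rcons_tuple -[RHS]IH; apply: eq_bigr => b _.
have massS y : mass (joint_belief (rcons_tuple b y)) = \sum_x \sum_s joint_letter b x s y.
  by rewrite joint_beliefS mass_advance //; exact: joint_letter_feasible.
under eq_bigr => y _ do rewrite massS.
rewrite exchange_big; apply: eq_bigr => x _; rewrite exchange_big; apply: eq_bigr => s _.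
exact: sum_joint_letter.
Qed.

Lemma sum_law T : \sum_a \sum_b law (T := T) a b = 1.
Proof.
rewrite exchange_big -[RHS](sum_mass_joint_belief T) /=.
by apply: eq_bigr => b _; rewrite mass_joint_belief.
Qed.

Lemma MI_law0 : MI (@law 0) = 0.
Proof.
by apply: (MI_constant_output (b0 := [tuple])) (sum_law 0) => a b; rewrite (tuple0 b) eqxx.
Qed.

Lemma leakT_law T : (0 < T)%N -> leakT Q PX1 PS1 q T = MI (@law T) / T%:R.
Proof.
move=> T_gt0; congr (MI _ / _).
by apply/funext => a; apply/funext => b; exact: jointXS1Y_trajectory.
Qed.

End Dynamics.

(** * Optimality *)

Section Limsup.
Variable R : realType.
Local Open Scope classical_set_scope.

Lemma natr_inv_small (c e : R) : 0 < e -> exists n, forall T, (n < T)%N -> c / T%:R <= e.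
Proof.
move=> e0; exists (Num.truncn (`|c| / e)).+1 => T lt_T.
have T_gt0 : 0 < T%:R :> R by rewrite ltr0n; lia.
rewrite ler_pdivrMr // (le_trans (ler_norm c)) // mulrC -ler_pdivrMr //.
apply: ltW; apply: (lt_le_trans (Num.Theory.truncnS_gt _)); rewrite ler_nat; exact: ltnW.
Qed.

Lemma limn_esup_le_rate (u : nat -> R) (l c : R) :
  (forall T, (0 < T)%N -> u T <= l + c / T%:R) -> (limn_esup (fun T => (u T)%:E) <= l%:E)%E.
Proof.
move=> u_le; apply/lee_addgt0Pr => e e0; have [n small] := natr_inv_small c e0.
apply: (@le_trans _ _ (ereal_sup ((fun T => (u T)%:E) @` [set T | (n < T)%N]))).
  by apply: ereal_inf_lbound; exists [set T | (n < T)%N] => //; exists n.+1.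
apply: ge_ereal_sup => _ [T /= lt_T <-]; rewrite -EFinD lee_fin.
by apply: (le_trans (u_le T _)); [lia | rewrite lerD2l small].
Qed.

Lemma limn_esup_ge_rate (u : nat -> R) (l c : R) :
  (forall T, (0 < T)%N -> l - c / T%:R <= u T) -> (l%:E <= limn_esup (fun T => (u T)%:E))%E.
Proof.
move=> u_ge; apply/lee_addgt0Pr => e e0; have [n small] := natr_inv_small c e0.
rewrite -leeBlDr //; apply: le_ereal_inf_tmp => _ [V [N _ NV] <-].
pose T := (maxn N n).+1.
apply: (@le_trans _ _ (u T)%:E); last first.
  by apply: ereal_sup_ubound; exists T => //; apply: NV; rewrite /= /T; lia.
rewrite -EFinB lee_fin; apply: le_trans (u_ge T _); last by rewrite /T; lia.
by rewrite lerD2l lerN2; apply: small; rewrite /T; lia.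
Qed.

End Limsup.

Section Optimality.
Variables (R : realType) (mx my ms : nat) (Q : 'M[R]_mx.+1).
Local Notation X := 'I_mx.+1.
Local Notation Y := 'I_my.+1.
Local Notation S := 'I_ms.+1.
Variables (PX1 : X -> R) (PS1 : S -> R).
Variable phi0 : (X -> S -> R) -> Y -> (X -> S -> Y -> R) -> X -> S -> R.
Variables (J : R) (v : (X -> S -> R) -> R) (f : (X -> S -> R) -> X -> S -> Y -> R).
Hypotheses (le_mx_my : (mx <= my)%N) (stoQ : stochastic Q).
Hypotheses (pmf_PX1 : is_pmf PX1) (pmf_PS1 : is_pmf PS1).
Hypothesis phi0_pmf : forall p y a, is_pmfXS (phi0 p y a).
Hypothesis optimality_eq : forall p, is_pmfXS p ->
  admissible (f p) /\
  (forall a, admissible a -> bellman Q phi0 (f p) v p <= bellman Q phi0 a v p) /\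
  J + v p = bellman Q phi0 (f p) v p.
Implicit Types (mu p : X -> S -> R) (q : policy R mx my ms) (T : nat).

Local Notation V := (perspective v).
Local Notation start := (fun (x : X) (s : S) => PX1 x * PS1 s).

Lemma optimality_le (a : X -> S -> Y -> R) mu : admissible a -> nonneg mu ->
  J * mass mu + V mu <= perspective (Iact a) mu + \sum_y V (observe Q a y mu).
Proof.
move=> adm_a mu0; rewrite -(perspective_bellman stoQ phi0) // mulrC -mulrDr.
apply: perspective_le (fun p => J + v p) _ _ mu0 _ => p pmf_p.
by have [_ [opt ->]] := optimality_eq pmf_p; exact: opt.
Qed.

Lemma optimality_eq_scale c p : is_pmfXS p ->
  J * c + V (scale c p) =
  perspective (Iact (f p)) (scale c p) + \sum_y V (observe Q (f p) y (scale c p)).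
Proof.
move=> pmf_p; have [adm_f [_ eqJ]] := optimality_eq pmf_p.
under eq_bigr => y _ do rewrite observe_scale perspective_scale.
rewrite !perspective_scale !perspective_pmf // -mulr_sumr [J * c]mulrC -!mulrDr.
by rewrite eqJ bellman_observe.
Qed.

Definition step_bound : R := `|J| + #|{: X * S}|%:R.

Lemma step_bound_ge0 : 0 <= step_bound. Proof. by rewrite addr_ge0. Qed.

Lemma value_subsolution : bellman_subsolution my Q v step_bound.
Proof.
move=> mu a mu0 adm_a; have := optimality_le adm_a mu0.
have info_le : perspective (Iact a) mu <= #|{: X * S}|%:R * mass mu.
  by rewrite [leRHS]mulrC; apply: (perspective_le (G := fun=> _) mu0) => p; exact: Iact_le_card.
have J_ge : - (`|J| * mass mu) <= J * mass mu.
  by rewrite -mulNr ler_wpM2r ?mass_ge0 // lerNnormlW.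
by rewrite /step_bound mulrDl; move: info_le J_ge; lra.
Qed.

Lemma belief_pmf ys : is_pmfXS (belief Q PX1 PS1 phi0 f ys).
Proof.
elim/last_ind: ys => [|ys y IH]; first exact: pmf_start.
rewrite /belief foldl_rcons -/(belief Q PX1 PS1 phi0 f ys).
set p := belief _ _ _ _ _ _ in IH *; have [adm_f _] := optimality_eq IH.
have [m0|mn] := eqVneq (mass (observe Q (f p) y p)) 0.
  move: m0; rewrite mass_observe // => m0.
  by rewrite /filt -/(mass (weigh (likelihood (f p) y) p)) m0 eqxx.
by rewrite filt_observe //; apply/pmf_normalize/mn/nonneg_observe => //; exact: pmf_nonneg.
Qed.

Local Notation qstar := (belief_policy Q PX1 PS1 phi0 f).

Lemma belief_policy_valid : valid_policy qstar.
Proof.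
move=> t xs ss ys _ _ _; have [adm_f _] := optimality_eq (belief_pmf ys).
exact: (adm_f (nth ord0 xs t) (nth ord0 ss t)).
Qed.

Local Notation joint_belief q T := (@joint_belief R mx my ms Q PX1 PS1 q T).
Local Notation information q T := (MI (@law R mx my ms Q PX1 PS1 q T)).

Definition mean_value q T : R := \sum_b V (joint_belief q T b).

Lemma mean_value0 q : mean_value q 0 = v start.
Proof.
by rewrite /mean_value sum_tuple0 joint_belief0 perspective_pmf //; exact: pmf_start.
Qed.

Section Policy.
Variables (q : policy R mx my ms) (valid_q : valid_policy q).

Lemma sum_optimality_lhs T :
  \sum_b (J * mass (joint_belief q T b) + V (joint_belief q T b)) = J + mean_value q T.
Proof. by rewrite big_split -mulr_sumr sum_mass_joint_belief ?mulr1. Qed.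

Lemma gain_mean_valueS T (act : T.-tuple Y -> X -> S -> Y -> R) :
  (forall b, admissible (act b)) ->
  (forall b x s y, joint_letter Q PX1 PS1 q b x s y = joint_belief q T b x s * act b x s y) ->
  gain Q PX1 PS1 q T + mean_value q T.+1 = \sum_b (perspective (Iact (act b)) (joint_belief q T b)
    + \sum_y V (observe Q (act b) y (joint_belief q T b))).
Proof.
move=> adm_act actE; rewrite (gain_observe stoQ pmf_PX1 pmf_PS1 valid_q adm_act actE).
rewrite big_split /mean_value sum_rcons_tuple; congr (_ + _).
apply: eq_bigr => b _; apply: eq_bigr => y _.
by rewrite (joint_belief_observe valid_q actE).
Qed.

Lemma mean_value_le T : J + mean_value q T <= gain Q PX1 PS1 q T + mean_value q T.+1.
Proof.
have adm b := induced_action_admissible stoQ pmf_PX1 pmf_PS1 valid_q (T := T) b le_mx_my.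
have actE b := induced_actionE stoQ pmf_PX1 pmf_PS1 valid_q (T := T) b.
rewrite (gain_mean_valueS adm actE) -sum_optimality_lhs.
apply: ler_sum => b _; apply: optimality_le => //; exact: nonneg_joint_belief.
Qed.

Lemma information_ge T : J * T%:R + v start <= information q T + mean_value q T.
Proof.
elim: T => [|T IH]; first by rewrite mulr0 add0r MI_law0 // mean_value0 add0r.
have := MI_law_ge stoQ pmf_PX1 pmf_PS1 valid_q T; have := mean_value_le T; move: IH.
by rewrite -natr1 mulrDr mulr1; lra.
Qed.

Lemma leakInf_ge B : (forall mu, nonneg mu -> V mu <= B * mass mu) ->
  (J%:E <= leakInf Q PX1 PS1 q)%E.
Proof.
move=> V_le; apply: (@limn_esup_ge_rate _ _ _ (B - v start)) => T T_gt0.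
have T_pos : 0 < T%:R :> R by rewrite ltr0n.
rewrite leakT_law // ler_pdivlMr // mulrBl divfK ?gt_eqF //.
have mean_le : mean_value q T <= B.
  rewrite -[leRHS]mulr1 -(sum_mass_joint_belief stoQ pmf_PX1 pmf_PS1 valid_q T) mulr_sumr.
  by apply: ler_sum => b _; apply: V_le; exact: nonneg_joint_belief.
by have := information_ge T; lra.
Qed.

End Policy.

Section OptimalPolicy.
Let valid_qstar := belief_policy_valid.

Let act T (b : T.-tuple Y) := f (belief Q PX1 PS1 phi0 f b).

Let act_admissible T (b : T.-tuple Y) : admissible (act b).
Proof. by have [] := optimality_eq (belief_pmf b). Qed.

Lemma letter_law_qstar T (a : T.-tuple X * S) b x y :
  letter_law qstar a b x y = act b x (charge_at a b) y.
Proof. by rewrite /letter_law /belief_policy nth_mkseq // nth_rcons_last // size_tuple. Qed.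

Lemma joint_letter_qstar T (b : T.-tuple Y) x s y :
  joint_letter Q PX1 PS1 qstar b x s y = joint_belief qstar T b x s * act b x s y.
Proof. exact/letter_mass_kernel/letter_law_qstar. Qed.

Lemma joint_belief_qstar T (b : T.-tuple Y) (y : Y) :
  joint_belief qstar T.+1 (rcons_tuple b y) = observe Q (act b) y (joint_belief qstar T b).
Proof. exact/joint_belief_observe/joint_letter_qstar. Qed.

Lemma joint_belief_scale T (b : T.-tuple Y) : joint_belief qstar T b =
  scale (mass (joint_belief qstar T b)) (belief Q PX1 PS1 phi0 f b).
Proof.
elim: T b => [|T IH] b.
  rewrite joint_belief0 pmf_mass; last exact: pmf_start.
  by rewrite (tuple0 b); apply/funext => x; apply/funext => s; rewrite /scale mul1r.
have [g _ gK] := rcons_tuple_bij Y T; rewrite -(gK b); case: (g b) => {g gK}b y /=.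
rewrite joint_belief_qstar IH observe_scale mass_scale.
rewrite [in LHS](observe_filt stoQ phi0 y (act_admissible b) (pmf_nonneg (belief_pmf b))).
by rewrite scale_scale /belief foldl_rcons.
Qed.

Lemma reachable_joint_belief T (b : T.-tuple Y) : reachable my Q start (joint_belief qstar T b).
Proof.
elim: T b => [|T IH] b; first by rewrite joint_belief0; exact: reachable_start.
have [g _ gK] := rcons_tuple_bij Y T; rewrite -(gK b); case: (g b) => {g gK}b y /=.
rewrite joint_belief_qstar; apply: reachable_advance => //.
by exists (act b).
Qed.

Lemma mean_value_qstar T :
  J + mean_value qstar T = gain Q PX1 PS1 qstar T + mean_value qstar T.+1.
Proof.
rewrite (gain_mean_valueS valid_qstar (@act_admissible T) (@joint_letter_qstar T)).
rewrite -(sum_optimality_lhs valid_qstar); apply: eq_bigr => b _.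
have pmf_b := belief_pmf b.
by rewrite joint_belief_scale -(optimality_eq_scale _ pmf_b) mass_scale (pmf_mass pmf_b) mulr1.
Qed.

Lemma information_qstar T : J * T%:R + v start = information qstar T + mean_value qstar T.
Proof.
elim: T => [|T IH]; first by rewrite mulr0 add0r MI_law0 // mean_value0 add0r.
have := mean_value_qstar T; move: IH.
rewrite (MI_law_eq stoQ pmf_PX1 pmf_PS1 valid_qstar (@letter_law_qstar T)).
by rewrite -natr1 mulrDr mulr1; lra.
Qed.

Lemma leakInf_qstar_le B : (forall mu, reachable my Q start mu -> - (B * mass mu) <= V mu) ->
  (leakInf Q PX1 PS1 qstar <= J%:E)%E.
Proof.
move=> V_ge; apply: (@limn_esup_le_rate _ _ _ (v start + B)) => T T_gt0.
have T_pos : 0 < T%:R :> R by rewrite ltr0n.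
rewrite leakT_law // ler_pdivrMr // mulrDl divfK ?gt_eqF //.
have mean_ge : - B <= mean_value qstar T.
  rewrite -[leLHS]mulr1 -(sum_mass_joint_belief stoQ pmf_PX1 pmf_PS1 valid_qstar T) mulr_sumr.
  by apply: ler_sum => b _; rewrite mulNr; apply: V_ge; exact: reachable_joint_belief.
by have := information_qstar T; lra.
Qed.

End OptimalPolicy.

Lemma optimality_random_demand : (0 < mx)%N -> irreducible Q ->
  (leakInf Q PX1 PS1 qstar <= J%:E)%E /\
  forall q, valid_policy q -> (J%:E <= leakInf Q PX1 PS1 q)%E.
Proof.
move=> mx_gt0 irr; have [B B0 V_le] := value_upper_bound le_mx_my stoQ step_bound_ge0
  value_subsolution (irreducible_diag_lt1 mx_gt0 ord_max stoQ irr).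
split; last by move=> q valid_q; exact: (leakInf_ge valid_q V_le).
have reach := reach_bound_of_subsolution stoQ B0 value_subsolution V_le.
have [B' _ V_ge] := value_lower_bound stoQ mx_gt0 le_mx_my (addr_ge0 step_bound_ge0 B0) reach
  (pmf_start pmf_PX1 pmf_PS1) (fun i => irreducible_column mx_gt0 i irr).
exact: leakInf_qstar_le V_ge.
Qed.

Section ConstantDemand.
Hypothesis mx0 : mx = 0%N.

Let demand0 (x : X) : x = ord0 := ord_eq0 x mx0.

Let full_battery : X -> S -> R := fun _ s => (s == ord_max)%:R.

Let pmf_full_battery : is_pmfXS full_battery.
Proof.
split=> [x s|]; first by rewrite ler0n.
rewrite (big_pred1 ord0) => [|x]; last by rewrite (demand0 x) /= eqxx.
by rewrite /full_battery (bigD1 ord_max) //= eqxx big1 ?addr0 // => s /negbTE ->.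
Qed.

Let letter0_certain (a : X -> S -> Y -> R) y : admissible a ->
  weigh (likelihood a y) full_battery = scale (y == ord0)%:R full_battery.
Proof.
move=> adm_a; apply/funext => x; apply/funext => s.
rewrite /weigh /likelihood /full_battery /scale (demand0 x).
have [->|_] := eqVneq s ord_max; last by rewrite !mulr0.
have zero y' : y' != ord0 -> a ord0 ord_max y' = 0.
  move=> yn; apply/eqP; apply: contraNT yn => /(admissible_feasible adm_a) feas.
  exact/eqP/(letter0_forced feas).
have one : a ord0 ord_max ord0 = 1.
  have [_ [<- _]] := adm_a ord0 ord_max.
  by rewrite (bigD1 ord0) //= big1 ?addr0 // => y'; exact: zero.
by have [->|/zero ->] := eqVneq y ord0; rewrite ?one.
Qed.

Let observe_full_battery (a : X -> S -> Y -> R) y : admissible a ->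
  observe Q a y full_battery = scale (y == ord0)%:R full_battery.
Proof.
move=> adm_a; rewrite /observe letter0_certain // advance_scale.
have [->|_] := eqVneq y ord0; last first.
  by apply/funext => x; apply/funext => s; rewrite /scale !mul0r.
congr scale; rewrite (advance_known_demand Q (x0 := ord0)) // => [|x s]; last first.
  by rewrite (demand0 x).
apply/funext => x; apply/funext => s; rewrite /prod_belief.
have -> : Q ord0 x = 1.
  rewrite -[RHS](stochastic_sum1 stoQ ord0) (big_pred1 x) // => x'.
  by rewrite (demand0 x) (demand0 x') /= eqxx.
exact: mul1r.
Qed.

(* With a full battery and no demand the letter 0 is forced. *)
Lemma constant_demand_value0 : J = 0.
Proof.
have [adm_f [_]] := optimality_eq pmf_full_battery; set a := f _ in adm_f *.
suff -> : bellman Q phi0 a v full_battery = v full_battery by lra.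
rewrite bellman_observe //.
have -> : Iact a full_battery = 0.
  apply: (MI_constant_output (b0 := ord0)) => [xs y yn|].
    have := congr1 (fun mu => mu xs.1 xs.2) (letter0_certain y adm_f).
    by rewrite /weigh /likelihood /scale (negbTE yn) mul0r mulrC.
  rewrite -(pair_bigA _ (fun x s => \sum_y full_battery x s * a x s y)).
  rewrite -[RHS](pmf_mass pmf_full_battery).
  apply: eq_bigr => x _; apply: eq_bigr => s _; rewrite -mulr_sumr.
  by have [_ [-> _]] := adm_f x s; rewrite mulr1.
under eq_bigr => y _ do rewrite observe_full_battery // perspective_scale.
rewrite (bigD1 ord0) //= mul1r big1 => [|y /negbTE ->]; last by rewrite mul0r.
by rewrite perspective_pmf // addr0 add0r.
Qed.

Lemma leakInf_constant_demand q : valid_policy q -> leakInf Q PX1 PS1 q = 0%:E.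
Proof.
move=> valid_q; have law0 T := law_ge0 stoQ pmf_PX1 pmf_PS1 valid_q (T := T).
have card_inputs T : #|{: T.-tuple X * S}| = ms.+1.
  by rewrite card_prod card_tuple !card_ord mx0 exp1n mul1n.
apply/le_anti/andP; split.
  apply: (@limn_esup_le_rate _ _ _ ms.+1%:R) => T T_gt0.
  rewrite leakT_law // add0r ler_wpM2r ?invr_ge0 //.
  by apply: (le_trans (MI_le_card (law0 T))); rewrite card_inputs.
apply: (@limn_esup_ge_rate _ _ _ 0) => T T_gt0.
rewrite leakT_law // mul0r subr0 divr_ge0 //; apply: MI_ge0 => //.
exact: sum_law.
Qed.

End ConstantDemand.

End Optimality.

Unset Implicit Arguments.
Local Open Scope classical_set_scope.

Theorem theorem2 (R : realType) (mx my ms : nat) (Q : 'M[R]_mx.+1)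
  (PX1 : 'I_mx.+1 -> R) (PS1 : 'I_ms.+1 -> R)
  (phi0 : ('I_mx.+1 -> 'I_ms.+1 -> R) -> 'I_my.+1 ->
          ('I_mx.+1 -> 'I_ms.+1 -> 'I_my.+1 -> R) -> 'I_mx.+1 -> 'I_ms.+1 -> R)
  (J : R) (v : ('I_mx.+1 -> 'I_ms.+1 -> R) -> R)
  (f : ('I_mx.+1 -> 'I_ms.+1 -> R) -> 'I_mx.+1 -> 'I_ms.+1 -> 'I_my.+1 -> R) :
  (mx <= my)%N ->
  stochastic Q -> irreducible Q -> aperiodic Q ->
  is_pmf PX1 -> is_pmf PS1 ->
  (forall pi y a, is_pmfXS (phi0 pi y a)) ->
  (forall pi, is_pmfXS pi ->
     admissible (f pi) /\
     (forall a, admissible a -> bellman Q phi0 (f pi) v pi <= bellman Q phi0 a v pi) /\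
     J + v pi = bellman Q phi0 (f pi) v pi) ->
  let qstar := belief_policy Q PX1 PS1 phi0 f in
  [/\ valid_policy qstar,
      (forall q : policy R mx my ms, valid_policy q -> (leakInf Q PX1 PS1 qstar <= leakInf Q PX1 PS1 q)%E)
    & ereal_inf [set leakInf Q PX1 PS1 q | q in @valid_policy R mx my ms] = J%:E].
Proof.
move=> le_mx_my stoQ irr _ pmf_PX1 pmf_PS1 phi0_pmf optimality_eq qstar.
have valid_qstar : valid_policy qstar.
  exact: (belief_policy_valid stoQ pmf_PX1 pmf_PS1 phi0_pmf optimality_eq).
have [qstar_le ge_J] : (leakInf Q PX1 PS1 qstar <= J%:E)%E /\
    forall q : policy R mx my ms, valid_policy q -> (J%:E <= leakInf Q PX1 PS1 q)%E.
  have [mx0|mx_gt0] := posnP mx; last first.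
    exact: (optimality_random_demand le_mx_my stoQ pmf_PX1 pmf_PS1 phi0_pmf
              optimality_eq mx_gt0 irr).
  have J0 := constant_demand_value0 stoQ optimality_eq mx0.
  by split=> [|q valid_q]; rewrite J0 (leakInf_constant_demand stoQ pmf_PX1 pmf_PS1 mx0).
split=> // [q valid_q|]; first exact: le_trans qstar_le (ge_J q valid_q).
apply/le_anti/andP; split.
  by apply: le_trans qstar_le; apply: ereal_inf_lbound; exists qstar.
by apply: le_ereal_inf_tmp => _ [q valid_q <-]; exact: ge_J.
Qed.
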